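(* Let $c\in\mathbb{R}$ be a constant and let $(M^2,g)$ be a Riemannian surface with Gaussian curvature $K$ satisfying $(\operatorname{grad}K)(p)\neq0$ and $c-K(p)>0$ at any point $p\in M$. Let $X_1=\frac{\operatorname{grad}K}{|\operatorname{grad}K|}$ and let $X_2$ be a vector field on $M$ such that $\{X_1(p),X_2(p)\}$ is a positively oriented orthonormal basis at any point $p\in M$. Then $$X_2X_1K=0\quad\text{and}\quad \nabla_{X_2}X_2=-\frac{3X_1K}{8(c-K)}X_1$$ if and only if the Riemannian metric $g$ can be locally written as $g=e^{2\varphi(u)}(du^2+dv^2)$, where $\varphi$ satisfies the equation $$8c\,e^{2\varphi(u)}\varphi'(u)+2\varphi'(u)\varphi''(u)+3\varphi'''(u)=0$$ and the conditions $$K'(u)=e^{-2\varphi(u)}\left(2\varphi'(u)\varphi''(u)-\varphi'''(u)\right)\neq0$$ and $$c-K(u)=c+e^{-2\varphi(u)}\varphi''(u)>0,$$ for any $u$ in some open interval $I$.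
   Context: $\nabla$ is the Levi-Civita connection of $g$, and $X_2X_1K=X_2(X_1(K))$. ''Locally written'' means that around each point of $M$ there are local coordinates $(u,v)$ in which $g$ has the stated form, with $\varphi$ depending only on $u$; in such coordinates $K$ depends only on $u$ and is denoted $K(u)$. *)

(* Defs.v *)
From mathcomp Require Import all_boot all_order all_algebra.
From mathcomp Require Import all_classical all_reals all_analysis.

Set Implicit Arguments.
Unset Strict Implicit.
Unset Printing Implicit Defensive.

Import Order.TTheory GRing.Theory Num.Theory.
Import numFieldNormedType.Exports.

Local Open Scope classical_set_scope.
Local Open Scope ring_scope.

Notation plane R := (R * R)%type.

Section PlaneCalculus.
Variable R : realType.

Definition e1 : plane R := (1, 0).
Definition e2 : plane R := (0, 1).

Definition det2 (v w : plane R) : R := v.1 * w.2 - v.2 * w.1.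

(* [A] is meant to be open. From rank 1 on, continuity of [f] itself follows
   from the continuity of its partial derivatives. *)
Fixpoint class_C (n : nat) (A : set (plane R)) (f : plane R -> R) : Prop :=
  match n with
  | 0 => forall x, A x -> {for x, continuous f}
  | m.+1 => (forall x, A x -> derivable f x e1 /\ derivable f x e2) /\
            class_C m A ('D_e1 f) /\ class_C m A ('D_e2 f)
  end.

Definition smooth (A : set (plane R)) (f : plane R -> R) : Prop :=
  forall n, class_C n A f.

Definition smooth_map (A : set (plane R)) (F : plane R -> plane R) : Prop :=
  smooth A (fst \o F) /\ smooth A (snd \o F).

Definition jacobian (F : plane R -> plane R) (x : plane R) : R :=
  det2 ('D_e1 F x) ('D_e2 F x).

Definition smooth1 (I : set R) (f : R -> R) : Prop :=
  forall n t, I t -> derivable (f^`(n)%classic) t 1.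

End PlaneCalculus.

(* [chart_inv] inverts [chart_map] on [chart_dom]; the values of [chart_map]
   outside [chart_dom] and of [chart_inv] outside the image of [chart_dom] are
   irrelevant. *)
Record chart (R : realType) (M : topologicalType) := Chart {
  chart_dom : set M;
  chart_map : M -> plane R;
  chart_inv : plane R -> M;
  chart_dom_open : open chart_dom;
  chart_image_open : open (chart_map @` chart_dom);
  chart_mapK : forall p, chart_dom p -> chart_inv (chart_map p) = p;
  chart_map_continuous : forall p, chart_dom p -> {for p, continuous chart_map};
  chart_inv_continuous : forall x, (chart_map @` chart_dom) x ->
    {for x, continuous chart_inv}
}.

Definition overlap (R : realType) (M : topologicalType) (k l : chart R M) :
  set (plane R) := chart_map k @` (chart_dom k `&` chart_dom l).

Definition transition (R : realType) (M : topologicalType) (k l : chart R M) :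
  plane R -> plane R := chart_map l \o chart_inv k.

(* The oriented atlas is [{chart_at p | p in M}]; [chart_at] also distinguishes
   a chart around every point, which is used below to represent tangent
   spaces. *)
Record oriented_surface (R : realType) := OrientedSurface {
  carrier :> topologicalType;
  surface_hausdorff : hausdorff_space carrier;
  surface_second_countable : @second_countable carrier;
  chart_at : carrier -> chart R carrier;
  mem_chart_at : forall p, chart_dom (chart_at p) p;
  atlas_smooth : forall p q,
    smooth_map (overlap (chart_at p) (chart_at q))
               (transition (chart_at p) (chart_at q));
  atlas_oriented : forall p q x, overlap (chart_at p) (chart_at q) x ->
    0 < jacobian (transition (chart_at p) (chart_at q)) x
}.

Section Surface.
Variables (R : realType) (M : oriented_surface R).

(* Charts of the maximal smooth atlas of [M]. No orientation condition. *)
Definition local_coordinates (k : chart R M) : Prop :=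
  forall p : M,
    smooth_map (overlap k (chart_at p)) (transition k (chart_at p)) /\
    smooth_map (overlap (chart_at p) k) (transition (chart_at p) k).

Definition smooth_on (A : set M) (f : M -> R) : Prop :=
  forall q : M, smooth (chart_map (chart_at q) @` (chart_dom (chart_at q) `&` A))
                       (f \o chart_inv (chart_at q)).

Definition smooth_fun (f : M -> R) : Prop := smooth_on setT f.

(* The tangent space at [p] is [plane R]: a tangent vector at [p] is given by
   its components in the distinguished chart [chart_at p]. Since the atlas is
   oriented, [0 < det2 v w] says that [v, w] is a positively oriented basis of
   the tangent space. A vector field is a function [M -> plane R]. *)
Definition differential (f : M -> R) (p : M) (v : plane R) : R :=
  'D_v (f \o chart_inv (chart_at p)) (chart_map (chart_at p) p).

(* [act X f] is the function X f. *)
Definition act (X : M -> plane R) (f : M -> R) (p : M) : R :=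
  differential f p (X p).

(* Smoothness of the components X u and X v in every chart (u, v). *)
Definition smooth_field (X : M -> plane R) : Prop :=
  forall q : M,
    smooth_on (chart_dom (chart_at q)) (act X (fst \o chart_map (chart_at q))) /\
    smooth_on (chart_dom (chart_at q)) (act X (snd \o chart_map (chart_at q))).

(* The tangent vector at [p] whose components in the chart [k] are [w]. *)
Definition chart_vector (k : chart R M) (w : plane R) (p : M) : plane R :=
  'D_w (transition k (chart_at p)) (chart_map k p).

(* Components of [X, Y] at [p] in the chart [chart_at p] = (u, v), from
   [X, Y] f = X (Y f) - Y (X f). *)
Definition bracket (X Y : M -> plane R) (p : M) : plane R :=
  let u := fst \o chart_map (chart_at p) in
  let v := snd \o chart_map (chart_at p) in
  (act X (act Y u) p - act Y (act X u) p,
   act X (act Y v) p - act Y (act X v) p).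

Record riemannian_metric := RiemannianMetric {
  inner :> M -> plane R -> plane R -> R;
  inner_linear : forall p a v w z,
    inner p (a *: v + w) z = a * inner p v z + inner p w z;
  inner_sym : forall p v w, inner p v w = inner p w v;
  inner_pos : forall p v, v != 0 -> 0 < inner p v v;
  inner_smooth : forall (q : M) (w z : plane R),
    smooth_on (chart_dom (chart_at q))
      (fun p => inner p (chart_vector (chart_at q) w p)
                        (chart_vector (chart_at q) z p))
}.

Variable g : riemannian_metric.

Definition metric_norm (p : M) (v : plane R) : R := Num.sqrt (g p v v).

(* [xget] picks the unique vector dual to the differential of [f]. *)
Definition grad (f : M -> R) (p : M) : plane R :=
  xget 0 [set w | forall v, g p w v = differential f p v].

Definition oriented_orthonormal (p : M) (v w : plane R) : Prop :=
  [/\ g p v v = 1, g p w w = 1, g p v w = 0 & 0 < det2 v w].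

Definition affine_connection
    (nabla : (M -> plane R) -> (M -> plane R) -> (M -> plane R)) : Prop :=
  [/\ forall X Y, smooth_field X -> smooth_field Y -> smooth_field (nabla X Y),
      forall a b X Y Z, smooth_fun a -> smooth_fun b ->
        smooth_field X -> smooth_field Y -> smooth_field Z ->
        forall p, nabla (fun q => a q *: X q + b q *: Y q) Z p
                  = a p *: nabla X Z p + b p *: nabla Y Z p,
      forall X Y Z, smooth_field X -> smooth_field Y -> smooth_field Z ->
        forall p, nabla X (fun q => Y q + Z q) p = nabla X Y p + nabla X Z p
    & forall a X Y, smooth_fun a -> smooth_field X -> smooth_field Y ->
        forall p, nabla X (fun q => a q *: Y q) p
                  = a p *: nabla X Y p + act X a p *: Y p].

Definition levi_civita
    (nabla : (M -> plane R) -> (M -> plane R) -> (M -> plane R)) : Prop :=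
  [/\ affine_connection nabla,
      forall X Y, smooth_field X -> smooth_field Y ->
        forall p, nabla X Y p - nabla Y X p = bracket X Y p
    & forall X Y Z, smooth_field X -> smooth_field Y -> smooth_field Z ->
        forall p, act X (fun q => g q (Y q) (Z q)) p
                  = g p (nabla X Y p) (Z p) + g p (Y p) (nabla X Z p)].

Definition curvature
    (nabla : (M -> plane R) -> (M -> plane R) -> (M -> plane R))
    (X Y Z : M -> plane R) (p : M) : plane R :=
  nabla X (nabla Y Z) p - nabla Y (nabla X Z) p - nabla (bracket X Y) Z p.

(* K(p) is the sectional curvature of the tangent plane at p: with the sign
   convention of [curvature], round spheres have K > 0. *)
Definition gaussian_curvature
    (nabla : (M -> plane R) -> (M -> plane R) -> (M -> plane R))
    (K : M -> R) : Prop :=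
  forall X Y, smooth_field X -> smooth_field Y ->
  forall p, det2 (X p) (Y p) != 0 ->
    K p = g p (curvature nabla X Y Y p) (X p)
          / (g p (X p) (X p) * g p (Y p) (Y p) - g p (X p) (Y p) ^+ 2).

End Surface.

(* Main.v *)
Require Import Defs.
From mathcomp Require Import all_boot all_order all_algebra.
From mathcomp Require Import all_classical all_reals all_analysis.
From mathcomp Require Import ring lra.
Import Order.TTheory GRing.Theory Num.Theory.
Import numFieldNormedType.Exports.
Local Open Scope classical_set_scope.
Local Open Scope ring_scope.
Set Implicit Arguments.
Unset Strict Implicit.
Unset Printing Implicit Defensive.

(** Write [X1, X2] for the frame, [geod1 = g (nabla_X1 X1, X2)] and
    [geod2 = g (nabla_X2 X2, X1)] for its geodesic curvatures. Metric
    compatibility and vanishing torsion give [nabla_X2 X2 = geod2 X1] and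
    [[X1, X2] = - geod1 X1 + geod2 X2]. By definition of [X1] one has [X2 K = 0]
    and [X1 K > 0], so applying the bracket to [K] yields [X2 X1 K = geod1 X1 K]
    ([act21_K]). The two conditions on the frame therefore say that [geod1 = 0]
    and [geod2 = - 3 X1 K / (8 (c - K))]. The right-hand side is [- X1 Phi] for
    [Phi = - (3/8) ln (c - K)], and this is the function that becomes [phi].

    From the frame to the coordinates, put [rho = exp (- Phi) = (c - K) ^ (3/8)]
    and let [theta1, theta2] be the dual coframe. As [[X1, X2] = geod2 X2],
    [X1 rho = geod2 rho] and [X2 rho = 0], the forms [rho theta1] and
    [rho theta2] are closed ([exterior_derivative]). The Poincare lemma
    ([poincare]) and the inverse function theorem ([inverse_function]) make
    their primitives into coordinates (u, v) ([isothermal_chart]), in which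
    [g = rho ^ -2 (du ^ 2 + dv ^ 2)]. Since [X2 K = 0], [K] is a function [k] of
    [u], and so is [Phi]. The curvature equation [K = X1 geod2 - geod2 ^ 2]
    ([curvature_geodesic]) becomes [k = - exp (- 2 phi) phi'']; differentiating
    it gives the formula for [k'], and [8 (c - k) phi' = 3 k'], which is the
    definition of [phi] differentiated, is the differential equation
    ([isothermal_ode]).

    Conversely, in such coordinates [X1] and [X2] are tangent to the lines of
    [u] and of [v], with [(X1 u) ^ 2 = (X2 v) ^ 2 = exp (- 2 phi u)]; the
    bracket applied to [u] and [v] gives [geod1 = 0] and [geod2 = - phi' X1 u]
    ([isothermal_frame]), and the differential equation turns the latter into
    [- 3 X1 K / (8 (c - K))].

    The field [X1] is smooth because it is [X2] rotated by a right angle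
    ([smooth_rotation]), and [K] is then smooth by its expression in the frame.
    *)

Local Notation dx := (e1 _).
Local Notation dy := (e2 _).

(** * Partial derivatives in the plane *)

Section PlaneDifferentials.
Variable R : realType.
Implicit Types (f g : plane R -> R) (x y z v w : plane R).

(** Partial derivatives are one-variable derivatives along coordinate lines, to
    which the one-variable theorems apply. *)
Lemma is_derive_line1 f x d :
  is_derive x dx f d <-> is_derive x.1 1 (fun t => f (t, x.2)) d.
Proof.
have E : (fun h => h^-1 *: ((f \o shift x) (h *: dx) - f x)) =
  (fun h => h^-1 *: (((fun t => f (t, x.2)) \o shift x.1) (h *: 1) - f (x.1, x.2))).
  apply/funext => h /=; congr (_ *: (f _ - f _)); last by case: x.
  by congr pair; rewrite /= ?scaler0 ?add0r.
have D : derivable f x dx = derivable (fun t => f (t, x.2)) x.1 1.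
  by rewrite /derivable E.
have V : 'D_dx f x = 'D_1 (fun t => f (t, x.2)) x.1.
  by rewrite /derive E.
by split=> -[a b]; split; [rewrite -D|rewrite -V|rewrite D|rewrite V].
Qed.

Lemma is_derive_line2 f x d :
  is_derive x dy f d <-> is_derive x.2 1 (fun t => f (x.1, t)) d.
Proof.
have E : (fun h => h^-1 *: ((f \o shift x) (h *: dy) - f x)) =
  (fun h => h^-1 *: (((fun t => f (x.1, t)) \o shift x.2) (h *: 1) - f (x.1, x.2))).
  apply/funext => h /=; congr (_ *: (f _ - f _)); last by case: x.
  by congr pair; rewrite /= ?scaler0 ?add0r.
have D : derivable f x dy = derivable (fun t => f (x.1, t)) x.2 1.
  by rewrite /derivable E.
have V : 'D_dy f x = 'D_1 (fun t => f (x.1, t)) x.2.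
  by rewrite /derive E.
by split=> -[a b]; split; [rewrite -D|rewrite -V|rewrite D|rewrite V].
Qed.

Lemma MVT_unordered (h dh : R -> R) (a b : R) :
  (forall t : R, Num.min a b <= t <= Num.max a b -> is_derive t 1 h (dh t)) ->
  exists2 c, Num.min a b <= c <= Num.max a b & h b - h a = dh c * (b - a).
Proof.
wlog ab : a b / a <= b => [W D|].
  have /orP[/W/(_ D)//|ba] := le_total a b.
  have [|c cab E] := W _ _ ba; first by rewrite minC maxC.
  by exists c; [rewrite minC maxC|lra].
rewrite min_l// max_r// => D.
have [||c cab E] := @MVT_segment R h dh a b ab.
- by move=> t; rewrite in_itv/= => /andP[? ?]; apply: D; rewrite !ltW.
- apply: derivable_within_continuous => t; rewrite in_itv/= => tab.
  by have [] := D t tab.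
- by exists c.
Qed.

Lemma ball_planeE x r y :
  ball x r y <-> `|x.1 - y.1| < r /\ `|x.2 - y.2| < r.
Proof. by split=> -[]. Qed.

Lemma ltr_dist_between (a b c t r : R) : `|c - a| < r -> `|c - b| < r ->
  Num.min a b <= t <= Num.max a b -> `|c - t| < r.
Proof.
rewrite !ltr_norml; move=> /andP[? ?] /andP[? ?].
rewrite ge_min le_max => /andP[/orP[?|?] /orP[?|?]]; apply/andP; split; lra.
Qed.

(** Mean value theorem along the broken line joining [z] to [y] through
    [(z.1, y.2)]. *)
Lemma MVT_plane f x r y z :
  (forall w, ball x r w -> derivable f w dx /\ derivable f w dy) ->
  ball x r y -> ball x r z ->
  exists w w', [/\ ball x r w, ball x r w' &
    f y - f z = 'D_dx f w * (y.1 - z.1) + 'D_dy f w' * (y.2 - z.2)].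
Proof.
move=> D /ball_planeE[y1 y2] /ball_planeE[z1 z2].
have [|c1 c1B E1] := @MVT_unordered (fun t => f (t, y.2))
    (fun t => 'D_dx f (t, y.2)) z.1 y.1.
  move=> t tB; apply/(is_derive_line1 f (t, y.2)).
  have [|? _] := D (t, y.2); first by split=> //=; exact: ltr_dist_between tB.
  exact: derivableP.
have [|c2 c2B E2] := @MVT_unordered (fun t => f (z.1, t))
    (fun t => 'D_dy f (z.1, t)) z.2 y.2.
  move=> t tB; apply/(is_derive_line2 f (z.1, t)).
  have [|_ ?] := D (z.1, t); first by split=> //=; exact: ltr_dist_between tB.
  exact: derivableP.
exists (c1, y.2), (z.1, c2); split.
- by split=> //=; exact: ltr_dist_between c1B.
- by split=> //=; exact: ltr_dist_between c2B.
- rewrite -E1 -E2; case: (y) (z) => ? ? [? ?] /=; lra.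
Qed.

Lemma norm_plane x : `|x| = Num.max `|x.1| `|x.2|.
Proof. exact: prod_normE. Qed.

Lemma ler_norm_fst x : `|x.1| <= `|x|. Proof. by rewrite norm_plane le_max lexx. Qed.
Lemma ler_norm_snd x : `|x.2| <= `|x|. Proof. by rewrite norm_plane le_max lexx orbT.
  Qed.

Lemma plane_decomp v : v = v.1 *: dx + v.2 *: dy.
Proof.
case: v => a b; congr pair => /=; rewrite /GRing.scale /=; lra.
Qed.

Lemma derive_partials f x v : differentiable f x ->
  'D_v f x = v.1 * 'D_dx f x + v.2 * 'D_dy f x.
Proof.
move=> df; rewrite !deriveE// {1}(plane_decomp v) linearD !linearZ//.
Qed.

(** Differentiability by first-order estimates, the form in which it is obtained
    from the mean value theorem and for inverse maps. *)
Lemma differentiable_plane f x a b :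
  (forall e, 0 < e -> \forall y \near x,
     `|f y - f x - (a * (y.1 - x.1) + b * (y.2 - x.2))| <= e * `|y - x|) ->
  [/\ differentiable f x, 'D_dx f x = a & 'D_dy f x = b].
Proof.
move=> H.
pose L : {linear plane R -> R} :=
  (a \*: (fst : {linear plane R -> R}) \+ b \*: (snd : {linear plane R -> R})).
have LE v : L v = a * v.1 + b * v.2 by [].
have cL : continuous L.
  move=> v; rewrite /continuous_at.
  have -> : (L : plane R -> R) = (fun v => a * v.1 + b * v.2) by exact/funext.
  by apply: cvgD; apply: cvgMr; [exact: cvg_fst|exact: cvg_snd].
have [dE E] : 'd f x = L :> (plane R -> R) /\
  f \o shift x = cst (f x) + 'd f x +o_ (0 : plane R) id.
  suff E : f \o shift x = (cst (f x) : plane R -> R) + (L : plane R ->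
    R) +o_ (0 : plane R) id.
    have dE := diff_unique cL E; split => //.
    by rewrite dE.
  apply/eqaddoP => e e0; have := H e e0; rewrite (near_shift 0 x) => Hn.
  near=> h.
  have /= : ((fun y => `|f y - f x - (a * (y.1 - x.1) + b * (y.2 - x.2))| <=
     e * `|y - x|) \o shift (x - 0)) h by near: h.
  rewrite subr0 addrK; apply: le_trans; rewrite le_eqVlt; apply/orP; left.
  apply/eqP; congr `| _ |.
  rewrite !fctE /= /GRing.scale /=; ring.
have df : differentiable f x.
  apply/diff_locallyP; split; last by exact: E. by rewrite dE.
by split=> //; rewrite deriveE// dE LE /= ?mulr0 ?mulr1 ?addr0 ?add0r.
Unshelve. all: by end_near. Qed.

Lemma near_ballP x (P : set (plane R)) :
  (\forall y \near x, P y) <-> exists2 r, 0 < r & ball x r `<=` P.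
Proof.
by split=> [/nbhs_ballP[r r0 H]|[r r0 H]]; [exists r|apply/nbhs_ballP; exists r].
Qed.

Lemma ball_normE_plane x r y : ball x r y <-> `|x - y| < r.
Proof.
by rewrite norm_plane gt_max ball_planeE; split=> [[-> ->]|/andP[]].
Qed.

(** The mean value theorem replaces each increment by a partial derivative at a
    nearby point, which by continuity differs little from the one at [x]. *)
Lemma differentiable_C1 f x :
  (\forall y \near x, derivable f y dx /\ derivable f y dy) ->
  {for x, continuous ('D_dx f)} -> {for x, continuous ('D_dy f)} ->
  differentiable f x.
Proof.
move=> D c1 c2.
suff [] : [/\ differentiable f x, 'D_dx f x = 'D_dx f x & 'D_dy f x = 'D_dy f x]
  by [].
apply: differentiable_plane => e e0.
have e20 : 0 < e / 2 by lra.
move/cvgrPdist_lt/(_ _ e20) : c1 => N1; move/cvgrPdist_lt/(_ _ e20) : c2 => N2.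
have N : \forall y \near x, [/\ derivable f y dx /\ derivable f y dy,
    `|'D_dx f x - 'D_dx f y| < e / 2 & `|'D_dy f x - 'D_dy f y| < e / 2].
  by apply: filterS3 D N1 N2 => y Dy W1 W2; split; [exact: Dy|exact: W1|exact: W2].
have /near_ballP[r r0 B] := N.
apply/near_ballP; exists r => // y xy.
have [|w [w' [/B[_ W1 _] /B[_ _ W2] ->]]] :=
  @MVT_plane f x r y x _ xy (ballxx x r0).
  by move=> w /B[].
move: W1 W2; move: ('D_dx f w) ('D_dx f x) ('D_dy f w') ('D_dy f x) => a a' b b'.
rewrite distrC => /ltW W1; rewrite distrC => /ltW W2.
have -> : a * (y.1 - x.1) + b * (y.2 - x.2) - (a' * (y.1 - x.1) + b' * (y.2 - x.2))
  = (a - a') * (y - x).1 + (b - b') * (y - x).2 by rewrite /=; ring.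
apply: le_trans (ler_normD _ _) _; rewrite !normrM.
have h1 := ler_pM (normr_ge0 _) (normr_ge0 _) W1 (ler_norm_fst (y - x)).
have h2 := ler_pM (normr_ge0 _) (normr_ge0 _) W2 (ler_norm_snd (y - x)).
by apply: le_trans (lerD h1 h2) _; rewrite -mulrDl -splitr.
Qed.

End PlaneDifferentials.

(** * Smooth functions of two variables *)

Section SmoothFunctions.
Variable R : realType.
Implicit Types (A B : set (plane R)) (f g h : plane R -> R) (x y v w : plane R).

Lemma class_C_sub n A B f : B `<=` A -> class_C n A f -> class_C n B f.
Proof.
move=> BA; elim: n f => [|n IH] f /= => [H x /BA|[H [H1 H2]]]; first exact: H.
by split; [move=> x /BA; exact: H|split; exact: IH].
Qed.

(** [class_C] is a conjunction of conditions on the derivatives of [f] at single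
    points, so it can be checked on any cover, open or not. *)
Lemma class_C_local n A f :
  (forall x, A x -> exists2 B, B x & class_C n B f) -> class_C n A f.
Proof.
elim: n f => [|n IH] f H /=; first by move=> x /H[B Bx]; exact.
split; first by move=> x /H[B Bx [] /(_ x Bx)].
by split; apply: IH => x /H[B Bx [_ [? ?]]]; exists B.
Qed.

Lemma near_open A x : open A -> A x -> \forall y \near x, A y.
Proof. by move=> oA Ax; exact: open_nbhs_nbhs. Qed.

Lemma class_C_eq n A f g : open A -> (forall x, A x -> f x = g x) ->
  class_C n A f -> class_C n A g.
Proof.
move=> oA; elim: n f g => [|n IH] f g fg /=.
  move=> H x Ax; rewrite /prop_for /continuous_at -fg//.
  apply: cvg_trans (H x Ax); apply: near_eq_cvg.
  by near=> y; apply: fg; near: y; exact: near_open.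
have N x : A x -> {near x, f =1 g}.
  by move=> Ax; near=> y; apply: fg; near: y; exact: near_open.
have D v x : A x -> 'D_v f x = 'D_v g x by move=> Ax; exact/near_eq_derive/N.
move=> [H [H1 H2]]; split.
  by move=> x Ax; have [? ?] := H x Ax; split; apply: near_eq_derivable (N x Ax) _.
by split; [apply: IH H1|apply: IH H2] => x; exact: D.
Unshelve. all: by end_near. Qed.

Lemma smooth_sub A B f : B `<=` A -> smooth A f -> smooth B f.
Proof. by move=> BA H n; exact: class_C_sub (H n). Qed.

Lemma smooth_local A f :
  (forall x, A x -> exists2 B, B x & smooth B f) -> smooth A f.
Proof.
by move=> H n; apply: class_C_local => x /H[B Bx Bf]; exists B.
Qed.

Lemma smooth_eq A f g : open A -> (forall x, A x -> f x = g x) ->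
  smooth A f -> smooth A g.
Proof. by move=> oA fg H n; exact: class_C_eq (H n). Qed.

Lemma smooth_dx A f : smooth A f -> smooth A ('D_dx f).
Proof. by move=> H n; have [_ []] := H n.+1. Qed.

Lemma smooth_dy A f : smooth A f -> smooth A ('D_dy f).
Proof. by move=> H n; have [_ []] := H n.+1. Qed.

Lemma smooth_continuous A f x : smooth A f -> A x -> {for x, continuous f}.
Proof. by move=> /(_ 0%N); exact. Qed.

Lemma smooth_derivable A f x : smooth A f -> A x ->
  derivable f x dx /\ derivable f x dy.
Proof. by move=> /(_ 1%N)[+ _]; exact. Qed.

Lemma smooth_differentiable A f x : open A -> smooth A f -> A x ->
  differentiable f x.
Proof.
move=> oA sf Ax; apply: differentiable_C1.
- near=> y; apply: smooth_derivable sf _.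
  by near: y; exact: near_open.
- exact: smooth_continuous (smooth_dx sf) Ax.
- exact: smooth_continuous (smooth_dy sf) Ax.
Unshelve. all: by end_near. Qed.

(** The inductive step of most closure properties below: [g] and [h] are the
    expected formulas for the partial derivatives of [f]. *)
Lemma class_C_step n A f g h : open A ->
  (forall x, A x -> [/\ differentiable f x, 'D_dx f x = g x & 'D_dy f x = h x]) ->
  class_C n A g -> class_C n A h -> class_C n.+1 A f.
Proof.
move=> oA H Cg Ch; split.
  by move=> x /H[d _ _]; split; exact: diff_derivable.
by split; [apply: class_C_eq Cg|apply: class_C_eq Ch] => // x /H[].
Qed.

Lemma smooth_step A f g h : open A ->
  (forall x, A x -> [/\ differentiable f x, 'D_dx f x = g x & 'D_dy f x = h x]) ->
  smooth A g -> smooth A h -> smooth A f.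
Proof.
move=> oA H sg sh [|n]; last exact: class_C_step oA H (sg n) (sh n).
by move=> x /H[+ _ _]; exact: differentiable_continuous.
Qed.

Lemma smooth_cst A (c : R) : open A -> smooth A (fun=> c).
Proof.
move=> oA n; elim: n c => [|n IH] c; first by move=> x _; exact: cst_continuous.
apply: (class_C_step oA _ (IH 0) (IH 0)) => x _.
by split; [exact: differentiable_cst|exact: derive_cst..].
Qed.

Lemma derive_fst x v : differentiable (fst : plane R -> R) x /\
  'D_v (fst : plane R -> R) x = v.1.
Proof.
have [|d E1 E2] := @differentiable_plane R fst x 1 0.
  move=> e e0; near=> y.
  have -> : y.1 - x.1 - (1 * (y.1 - x.1) + 0 * (y.2 - x.2)) = 0 by lra.
  by rewrite normr0 mulr_ge0// ltW.
by split=> //; rewrite derive_partials// E1 E2 mulr1 mulr0 addr0.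
Unshelve. all: by end_near. Qed.

Lemma derive_snd x v : differentiable (snd : plane R -> R) x /\
  'D_v (snd : plane R -> R) x = v.2.
Proof.
have [|d E1 E2] := @differentiable_plane R snd x 0 1.
  move=> e e0; near=> y.
  have -> : y.2 - x.2 - (0 * (y.1 - x.1) + 1 * (y.2 - x.2)) = 0 by lra.
  by rewrite normr0 mulr_ge0// ltW.
by split=> //; rewrite derive_partials// E1 E2 mulr1 mulr0 add0r.
Unshelve. all: by end_near. Qed.

Lemma smooth_fst A : open A -> smooth A fst.
Proof.
move=> oA; apply: (smooth_step oA _ (smooth_cst 1 oA) (smooth_cst 0 oA)) => x _.
by have [d1 ->] := derive_fst x dx; have [_ ->] := derive_fst x dy.
Qed.

Lemma smooth_snd A : open A -> smooth A snd.
Proof.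
move=> oA; apply: (smooth_step oA _ (smooth_cst 0 oA) (smooth_cst 1 oA)) => x _.
by have [d1 ->] := derive_snd x dx; have [_ ->] := derive_snd x dy.
Qed.

Lemma class_C_add n A f g : open A -> class_C n A f -> class_C n A g ->
  class_C n A (fun x => f x + g x).
Proof.
move=> oA; elim: n f g => [|n IH] f g.
  by move=> cf cg x Ax; apply: cvgD; [exact: cf|exact: cg].
move=> [df [f1 f2]] [dg [g1 g2]]; split.
  move=> x Ax; have [? ?] := df x Ax; have [? ?] := dg x Ax.
  by split; apply: derivableD.
have D v x : derivable f x v -> derivable g x v ->
  'D_v f x + 'D_v g x = 'D_v (fun x => f x + g x) x.
  by move=> ? ?; rewrite -deriveD.
by split; [apply: class_C_eq (IH _ _ f1 g1)|apply: class_C_eq (IH _ _ f2 g2)] =>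
  // x Ax;
  have [? ?] := df x Ax; have [? ?] := dg x Ax; exact: D.
Qed.

Lemma smooth_add A f g : open A -> smooth A f -> smooth A g ->
  smooth A (fun x => f x + g x).
Proof. by move=> oA sf sg n; apply: class_C_add. Qed.

Lemma class_C_mul n A f g : open A -> smooth A f -> smooth A g ->
  class_C n A (fun x => f x * g x).
Proof.
move=> oA; elim: n f g => [|n IH] f g sf sg.
  by move=> x Ax; apply: cvgM; exact: smooth_continuous Ax.
apply: (@class_C_step _ _ _ (fun x => f x * 'D_dx g x + g x * 'D_dx f x)
   (fun x => f x * 'D_dy g x + g x * 'D_dy f x)) => //.
- move=> x Ax; have [f1 f2] := smooth_derivable sf Ax.
  have [g1 g2] := smooth_derivable sg Ax.
  split; [|exact: (deriveM f1 g1)|exact: (deriveM f2 g2)].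
  exact: (differentiableM (smooth_differentiable oA sf Ax) (smooth_differentiable oA
    sg Ax)).
- exact: (class_C_add oA (IH _ _ sf (smooth_dx sg)) (IH _ _ sg (smooth_dx sf))).
- exact: (class_C_add oA (IH _ _ sf (smooth_dy sg)) (IH _ _ sg (smooth_dy sf))).
Qed.

Lemma smooth_mul A f g : open A -> smooth A f -> smooth A g ->
  smooth A (fun x => f x * g x).
Proof. by move=> oA sf sg n; exact: class_C_mul. Qed.

Lemma smooth_opp A f : open A -> smooth A f -> smooth A (fun x => - f x).
Proof.
move=> oA sf; apply: smooth_eq (smooth_mul oA (smooth_cst (-1) oA) sf) => // x _.
by rewrite mulN1r.
Qed.

Lemma smooth_sub_fun A f g : open A -> smooth A f -> smooth A g ->
  smooth A (fun x => f x - g x).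
Proof. by move=> oA sf sg; apply: smooth_add => //; exact: smooth_opp. Qed.

Lemma derive_comp_real (h : R -> R) f x v (d : R) :
  differentiable f x -> is_derive (f x) 1 h d ->
  differentiable (fun y => h (f y)) x /\
  'D_v (fun y => h (f y)) x = d * 'D_v f x.
Proof.
move=> df [dh <-].
have dh' : differentiable h (f x) by exact/derivable1_diffP.
have D : differentiable (h \o f) x by exact: differentiable_comp.
split=> //; rewrite deriveE// (deriveE _ df) (deriveE _ dh').
rewrite (@diff_comp _ _ _ _ f h)//= -[X in 'd h _ X = _]mulr1.
by rewrite [LHS]linearZ mulrC.
Qed.


(** The products [exp f * g] with [g] smooth form a family stable under
    differentiation, which makes the induction on the order go through; a single
    exponential does not. Likewise for all quotients in [smooth_div] and for the
    products [(f \o u) * g] in [smooth_comp]. *)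
Lemma smooth_expR A f : open A -> smooth A f -> smooth A (fun x => expR (f x)).
Proof.
move=> oA sf.
have D v x : A x -> differentiable (fun y => expR (f y)) x /\
   'D_v (fun y => expR (f y)) x = expR (f x) * 'D_v f x.
  move=> Ax; apply: derive_comp_real.
  exact: smooth_differentiable Ax.
have S n g : smooth A g -> class_C n A (fun x => expR (f x) * g x).
  elim: n g => [|n IH] g sg.
    move=> x Ax; apply: cvgM; last exact: smooth_continuous Ax.
    exact: (differentiable_continuous (D 0 x Ax).1).
  have [f1 f2] := (smooth_dx sf, smooth_dy sf).
  have [g1 g2] := (smooth_dx sg, smooth_dy sg).
  apply: (class_C_step oA _
    (IH _ (smooth_add oA g1 (smooth_mul oA f1 sg)))
    (IH _ (smooth_add oA g2 (smooth_mul oA f2 sg)))) => x Ax.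
  have dg := smooth_differentiable oA sg Ax.
  have E v : 'D_v (fun x => expR (f x) * g x) x =
      expR (f x) * ('D_v g x + 'D_v f x * g x).
    have [de Ee] := D v x Ax.
    rewrite (deriveM (diff_derivable de) (diff_derivable dg)) Ee /GRing.scale /=.
    by move: ('D_v f x) ('D_v g x) => ? ?; ring.
  by split; [exact: (differentiableM (D 0 x Ax).1 dg)|exact: E|exact: E].
move=> n; apply: class_C_eq (S n _ (smooth_cst 1 oA)) => // x _.
by rewrite mulr1.
Qed.

Lemma smooth_div A f g : open A -> smooth A f -> smooth A g ->
  (forall x, A x -> g x != 0) -> smooth A (fun x => f x / g x).
Proof.
move=> oA + + + n; elim: n f g => [|n IH] f g sf sg g0.
  move=> x Ax; apply: cvgM; first exact: smooth_continuous Ax.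
  by apply: cvgV; [exact: g0|exact: smooth_continuous Ax].
have [f1 f2] := (smooth_dx sf, smooth_dy sf).
have [g1 g2] := (smooth_dx sg, smooth_dy sg).
have gg x : A x -> g x * g x != 0 by move=> Ax; rewrite mulf_neq0// g0.
have ogg := smooth_mul oA sg sg.
apply: (class_C_step oA _
  (IH _ _ (smooth_sub_fun oA (smooth_mul oA f1 sg) (smooth_mul oA sf g1)) ogg gg)
  (IH _ _ (smooth_sub_fun oA (smooth_mul oA f2 sg) (smooth_mul oA sf g2)) ogg gg))
  => x Ax.
have df := smooth_differentiable oA sf Ax.
have dg := smooth_differentiable oA sg Ax.
have dV : differentiable (fun y => (g y)^-1) x.
  exact: (differentiableV dg (g0 x Ax)).
have E v : 'D_v (fun x => f x / g x) x =
    ('D_v f x * g x - f x * 'D_v g x) / (g x * g x).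
  rewrite (deriveM (diff_derivable df) (diff_derivable dV)).
  rewrite (deriveV (g0 x Ax) (diff_derivable dg)) /GRing.scale /=.
  by move: ('D_v f x) ('D_v g x) => ? ?; field; exact: g0.
by split; [exact: (differentiableM df dV)|exact: E|exact: E].
Qed.

Lemma smooth_ln A f : open A -> smooth A f -> (forall x, A x -> 0 < f x) ->
  smooth A (fun x => ln (f x)).
Proof.
move=> oA sf f0.
have D v x : A x -> differentiable (fun y => ln (f y)) x /\
   'D_v (fun y => ln (f y)) x = 'D_v f x / f x.
  move=> Ax; have := derive_comp_real v (smooth_differentiable oA sf Ax)
    (is_derive1_ln (f0 x Ax)).
  by rewrite mulrC.
have n0 x : A x -> f x != 0 by move=> Ax; rewrite gt_eqF ?f0.
apply: (smooth_step oA _ (smooth_div oA (smooth_dx sf) sf n0)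
  (smooth_div oA (smooth_dy sf) sf n0)) => x Ax.
by split; [exact: (D 0 x Ax).1|exact: (D _ x Ax).2..].
Qed.

Lemma derive_comp_plane f (u1 u2 : plane R -> R) x v :
  differentiable f (u1 x, u2 x) -> differentiable u1 x -> differentiable u2 x ->
  differentiable (fun y => f (u1 y, u2 y)) x /\
  'D_v (fun y => f (u1 y, u2 y)) x =
    'D_dx f (u1 x, u2 x) * 'D_v u1 x + 'D_dy f (u1 x, u2 x) * 'D_v u2 x.
Proof.
move=> df d1 d2.
have d12 : differentiable (fun y => (u1 y, u2 y)) x by exact: differentiable_pair.
have D : differentiable (f \o (fun y => (u1 y, u2 y))) x.
  exact: differentiable_comp.
split=> //; rewrite deriveE//.
rewrite (@diff_comp _ _ _ _ (fun y => (u1 y, u2 y)) f)//=.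
rewrite (diff_pair d1 d2) -(deriveE _ df) (derive_partials _ df) /=.
rewrite -(deriveE _ d1) -(deriveE _ d2).
by congr (_ + _); exact: mulrC.
Qed.

Lemma smooth_comp A B (f u1 u2 : plane R -> R) : open A -> open B ->
  smooth A u1 -> smooth A u2 -> (forall x, A x -> B (u1 x, u2 x)) ->
  smooth B f -> smooth A (fun x => f (u1 x, u2 x)).
Proof.
move=> oA oB s1 s2 AB sf.
have D h v x : smooth B h -> A x -> differentiable (fun y => h (u1 y, u2 y)) x /\
  'D_v (fun y => h (u1 y, u2 y)) x =
    'D_dx h (u1 x, u2 x) * 'D_v u1 x + 'D_dy h (u1 x, u2 x) * 'D_v u2 x.
  move=> sh Ax; apply: derive_comp_plane.
  - exact: smooth_differentiable oB sh (AB x Ax).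
  - exact: smooth_differentiable Ax.
  - exact: smooth_differentiable Ax.
have S n h g : smooth B h -> smooth A g ->
    class_C n A (fun x => h (u1 x, u2 x) * g x).
  elim: n h g => [|n IH] {sf}f g sf sg.
    move=> x Ax; apply: cvgM; last exact: smooth_continuous Ax.
    exact: (differentiable_continuous (D f 0 x sf Ax).1).
  have E v x : A x -> differentiable (fun x => f (u1 x, u2 x) * g x) x /\
     'D_v (fun x => f (u1 x, u2 x) * g x) x =
     'D_dx f (u1 x, u2 x) * ('D_v u1 x * g x) +
     ('D_dy f (u1 x, u2 x) * ('D_v u2 x * g x) + f (u1 x, u2 x) * 'D_v g x).
    move=> Ax; have [d e] := D f v x sf Ax.
    have dg := smooth_differentiable oA sg Ax.
    split; first exact: (differentiableM d dg).
    rewrite (deriveM (diff_derivable d) (diff_derivable dg)) e /GRing.scale /=.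
    move: ('D_v u1 x) ('D_v u2 x) ('D_v g x) => ? ? ?.
    by move: ('D_dx f _) ('D_dy f _) => ? ?; ring.
  have C g1 g2 g3 : smooth A g1 -> smooth A g2 -> smooth A g3 ->
     class_C n A (fun x => 'D_dx f (u1 x, u2 x) * (g1 x * g x) +
     ('D_dy f (u1 x, u2 x) * (g2 x * g x) + f (u1 x, u2 x) * g3 x)).
    move=> s1' s2' s3'; exact: (class_C_add oA
      (IH _ _ (smooth_dx sf) (smooth_mul oA s1' sg))
      (class_C_add oA (IH _ _ (smooth_dy sf) (smooth_mul oA s2' sg)) (IH _ _ sf s3'))).
  apply: (class_C_step oA _
    (C _ _ _ (smooth_dx s1) (smooth_dx s2) (smooth_dx sg))
    (C _ _ _ (smooth_dy s1) (smooth_dy s2) (smooth_dy sg))) => x Ax.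
  by split; [exact: (E 0 x Ax).1|exact: (E dx x Ax).2|exact: (E dy x Ax).2].
move=> n; apply: class_C_eq (S n f _ sf (smooth_cst 1 oA)) => // x _.
by rewrite mulr1.
Qed.

Lemma smooth_primitive A f (P Q : plane R -> R) : open A -> smooth A P -> smooth A Q ->
  (forall x, A x -> is_derive x dx f (P x) /\ is_derive x dy f (Q x)) ->
  smooth A f.
Proof.
move=> oA sP sQ H.
have E1 x : A x -> 'D_dx f x = P x by move=> /H[[_ ->]].
have E2 x : A x -> 'D_dy f x = Q x by move=> /H[_ [_ ->]].
apply: (smooth_step oA _ sP sQ) => x Ax; split; [|exact: E1|exact: E2].
apply: differentiable_C1.
- by apply: filterS (near_open oA Ax) => y /H[[? _] [? _]].
- apply: (smooth_continuous (smooth_eq oA _ sP) Ax) => y Ay.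
  by rewrite E1.
- apply: (smooth_continuous (smooth_eq oA _ sQ) Ax) => y Ay.
  by rewrite E2.
Qed.

(** The derivatives of the restriction to a horizontal line are the restrictions of
    the iterated derivatives along the first coordinate. *)
Lemma smooth1_line A (I : set R) h (b : R) : open I ->
  (forall t, I t -> A (t, b)) -> smooth A h -> smooth1 I (fun t => h (t, b)).
Proof.
move=> oI IA sh n.
suff [hn shn E] : exists2 hn, smooth A hn &
    forall t, I t -> (fun t => h (t, b))^`(n)%classic t = hn (t, b).
  move=> t It; have [D _] := smooth_derivable shn (IA t It).
  apply: (@near_eq_derivable _ _ _ (fun t => hn (t, b))).
    by apply: filterS (open_nbhs_nbhs (conj oI It)) => s Is; rewrite E.
  by have [] := (is_derive_line1 hn (t, b) _).1 (derivableP D).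
elim: n => [|n [hn shn E]]; first by exists h.
exists ('D_dx hn); first exact: smooth_dx.
move=> t It; rewrite derive1nS derive1E.
rewrite (@near_eq_derive _ _ _ _ (fun t => hn (t, b))).
  have [D _] := smooth_derivable shn (IA t It).
  by have [_ ] := (is_derive_line1 hn (t, b) _).1 (derivableP D).
by apply: filterS (open_nbhs_nbhs (conj oI It)) => s Is; rewrite E.
Qed.

End SmoothFunctions.

(** * Mixed derivatives and closed 1-forms *)

Section SchwarzPoincare.
Variable R : realType.
Implicit Types (A B : set (plane R)) (f g h : plane R -> R) (x y v w : plane R).

(** Two applications of the mean value theorem, to the difference of [f] between
    two horizontal sides and then to ['D_dx f]; [second_difference_yx] applies it
    in the other order. *)
Lemma second_difference_xy A f x r : open A -> smooth A f -> ball x r `<=` A ->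
  0 < r ->
  exists2 w, ball x r w &
  f (x.1 + r / 2, x.2 + r / 2) - f (x.1, x.2 + r / 2) - f (x.1 + r / 2, x.2)
  + f (x.1, x.2) = (r / 2) ^+ 2 * 'D_dy ('D_dx f) w.
Proof.
move=> oA sf xA r0; set s := r / 2.
have s0 : 0 < s by rewrite /s; lra.
have sr : s < r by rewrite /s; lra.
have between a t : Num.min a (a + s) <= t <= Num.max a (a + s) -> `|a - t| < r.
  rewrite min_l ?max_r; [|lra..] => /andP[? ?].
  by rewrite distrC ger0_norm; lra.
have aa (a : R) : `|a - a| < r by rewrite subrr normr0.
have as' a : `|a - (a + s)| < r by rewrite opprD addrA subrr add0r normrN ger0_norm//
  ltW.
have [|c /between cB E] := @MVT_unordered R
  (fun t => f (t, x.2 + s) - f (t, x.2))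
  (fun t => 'D_dx f (t, x.2 + s) - 'D_dx f (t, x.2)) x.1 (x.1 + s).
  move=> t /between tB; apply: is_deriveB.
  - apply/(is_derive_line1 f (t, x.2 + s)).
    by have [|/derivableP] := smooth_derivable sf (x := (t, x.2 + s));
      first by apply/xA/ball_planeE.
  - apply/(is_derive_line1 f (t, x.2)).
    by have [|/derivableP] := smooth_derivable sf (x := (t, x.2));
      first by apply/xA/ball_planeE.
have [|d /between dB E'] := @MVT_unordered R
  (fun t => 'D_dx f (c, t)) (fun t => 'D_dy ('D_dx f) (c, t)) x.2 (x.2 + s).
  move=> t /between tB; apply/(is_derive_line2 ('D_dx f) (c, t)).
  by have [|_ /derivableP] := smooth_derivable (smooth_dx sf) (x := (c, t));
    first by apply/xA/ball_planeE.
exists (c, d); first exact/ball_planeE.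
move: E; rewrite E' => E.
have -> : s ^+ 2 * 'D_dy ('D_dx f) (c, d) = 'D_dy ('D_dx f) (c, d) * (x.2 + s - x.2)
  * (x.1 + s - x.1).
  by ring.
rewrite -E; ring.
Qed.

Lemma second_difference_yx A f x r : open A -> smooth A f -> ball x r `<=` A ->
  0 < r ->
  exists2 w, ball x r w &
  f (x.1 + r / 2, x.2 + r / 2) - f (x.1, x.2 + r / 2) - f (x.1 + r / 2, x.2)
  + f (x.1, x.2) = (r / 2) ^+ 2 * 'D_dx ('D_dy f) w.
Proof.
move=> oA sf xA r0; set s := r / 2.
have s0 : 0 < s by rewrite /s; lra.
have sr : s < r by rewrite /s; lra.
have between a t : Num.min a (a + s) <= t <= Num.max a (a + s) -> `|a - t| < r.
  rewrite min_l ?max_r; [|lra..] => /andP[? ?].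
  by rewrite distrC ger0_norm; lra.
have aa (a : R) : `|a - a| < r by rewrite subrr normr0.
have as' a : `|a - (a + s)| < r by rewrite opprD addrA subrr add0r normrN ger0_norm//
  ltW.
have [|c /between cB E] := @MVT_unordered R
  (fun t => f (x.1 + s, t) - f (x.1, t))
  (fun t => 'D_dy f (x.1 + s, t) - 'D_dy f (x.1, t)) x.2 (x.2 + s).
  move=> t /between tB; apply: is_deriveB.
  - apply/(is_derive_line2 f (x.1 + s, t)).
    by have [|_ /derivableP] := smooth_derivable sf (x := (x.1 + s, t));
      first by apply/xA/ball_planeE.
  - apply/(is_derive_line2 f (x.1, t)).
    by have [|_ /derivableP] := smooth_derivable sf (x := (x.1, t));
      first by apply/xA/ball_planeE.
have [|d /between dB E'] := @MVT_unordered R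
  (fun t => 'D_dy f (t, c)) (fun t => 'D_dx ('D_dy f) (t, c)) x.1 (x.1 + s).
  move=> t /between tB; apply/(is_derive_line1 ('D_dy f) (t, c)).
  by have [|/derivableP] := smooth_derivable (smooth_dy sf) (x := (t, c));
    first by apply/xA/ball_planeE.
exists (d, c); first exact/ball_planeE.
move: E; rewrite E' => E.
have -> : s ^+ 2 * 'D_dx ('D_dy f) (d, c) = 'D_dx ('D_dy f) (d, c) * (x.1 + s - x.1)
  * (x.2 + s - x.2).
  by ring.
rewrite -E; ring.
Qed.

(** Continuous functions taking a common value arbitrarily close to [x], though
    perhaps at different points, agree at [x]. *)
Lemma eq_of_near_values (p q : plane R -> R) x A : open A -> A x ->
  {for x, continuous p} -> {for x, continuous q} ->
  (forall r, 0 < r -> ball x r `<=` A ->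
     exists w w', [/\ ball x r w, ball x r w' & p w = q w']) ->
  p x = q x.
Proof.
move=> oA Ax cp cq H; apply/eqP; rewrite -subr_eq0 -normr_le0.
apply/ler_addgt0Pl => e e0; rewrite addr0.
have e20 : 0 < e / 2 by lra.
move/cvgrPdist_lt/(_ _ e20) : cp => N1; move/cvgrPdist_lt/(_ _ e20) : cq => N2.
have /near_ballP[r r0 rH] : \forall y \near x,
    [/\ A y, `|p x - p y| < e / 2 & `|q x - q y| < e / 2].
  by apply: filterS3 (near_open oA Ax) N1 N2 => y; split.
have [|w [w' [/rH[_ W _] /rH[_ _ W'] E]]] := H r r0; first by move=> y /rH[].
move: W W'; rewrite E !ltr_norml => /andP[? ?] /andP[? ?].
by rewrite ler_norml; apply/andP; split; lra.
Qed.

(** Up to the factor [(r / 2) ^ 2], the second difference of [f] over a small square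
    with corner [x] is a value near [x] of either mixed derivative. *)
Lemma schwarz A f x : open A -> smooth A f -> A x ->
  'D_dy ('D_dx f) x = 'D_dx ('D_dy f) x.
Proof.
move=> oA sf Ax;
apply: (@eq_of_near_values ('D_dy ('D_dx f)) ('D_dx ('D_dy f)) x A oA Ax).
- exact: smooth_continuous (smooth_dy (smooth_dx sf)) Ax.
- exact: smooth_continuous (smooth_dx (smooth_dy sf)) Ax.
- move=> r r0 rA.
  have [w xw E] := second_difference_xy oA sf rA r0.
  have [w' xw' E'] := second_difference_yx oA sf rA r0.
  exists w, w'; split; [exact: xw|exact: xw'|].
  have r2 : (r / 2) ^+ 2 != 0 by rewrite expf_neq0// gt_eqF// divr_gt0.
  exact: (mulfI r2 (etrans (esym E) E')).
Qed.

Notation mu := (@lebesgue_measure R).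

Lemma is_derive_integral (q : R -> R) (a u t : R) : a < t < u ->
  (forall s, a <= s <= u -> {for s, continuous q}) ->
  is_derive t 1 (fun t => \int[mu]_(s in `[a, t]) q s) (q t).
Proof.
move=> /andP[a_t tu] cq.
have cI : {within `[a, u], continuous q}.
  by apply: continuous_in_subspaceT => s; rewrite inE /= in_itv /=; exact: cq.
have iq := continuous_compact_integrable (@segment_compact _ a u) cI.
have [D E] := continuous_FTC1_closed tu iq a_t (cq t ltac:(lra)).
by split; [exact: D|rewrite -derive1E; exact: E].
Qed.

Lemma integral_derive (F q : R -> R) (a b : R) : a < b ->
  (forall s, a <= s <= b -> is_derive s 1 F (q s) /\ {for s, continuous q}) ->
  \int[mu]_(s in `[a, b]) q s = F b - F a.
Proof.
move=> ab H.
have cF s : a <= s <= b -> {for s, continuous F}.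
  by move=> /H[[D _] _]; apply: differentiable_continuous; exact/derivable1_diffP.
rewrite /Rintegral (@continuous_FTC2 _ _ F)//.
- by apply: continuous_in_subspaceT => s; rewrite inE /= in_itv /= => /H[].
- split.
  + by move=> s; rewrite in_itv/= => /andP[? ?]; have [|[D _] _] := H s; [lra|exact: D].
  + by apply: cvg_at_right_filter; apply: cF; lra.
  + by apply: cvg_at_left_filter; apply: cF; lra.
- move=> s; rewrite in_itv/= => /andP[? ?]; have [|[_ E] _] := H s; first lra.
  by rewrite derive1E; exact: E.
Qed.

Lemma continuous_slice2 f t s :
  {for (t, s), continuous f} -> {for s, continuous (fun s => f (t, s))}.
Proof.
move=> cf; apply: (@continuous_comp _ _ _ (fun s => (t, s)) f) => //.
by apply: (@cvg_pair _ _ _ _ (nbhs t) (nbhs s) _ _ _ (fun=> t) id);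
  [exact: cvg_cst|exact: cvg_id].
Qed.

Lemma continuous_slice1 f t s :
  {for (t, s), continuous f} -> {for t, continuous (fun t => f (t, s))}.
Proof.
move=> cf; apply: (@continuous_comp _ _ _ (fun t => (t, s)) f) => //.
by apply: (@cvg_pair _ _ _ _ (nbhs t) (nbhs s) _ _ _ id (fun=> s));
  [exact: cvg_id|exact: cvg_cst].
Qed.

(** The primitive integrates [P dx] along the bottom side and then [Q dy] along a
    vertical line. Differentiating the second integral in [x] under the integral
    sign gives the integral of [Q_x = P_y]. *)
Lemma poincare (c : plane R) r (P Q : plane R -> R) : 0 < r ->
  smooth (ball c r) P -> smooth (ball c r) Q ->
  (forall x, ball c r x -> 'D_dy P x = 'D_dx Q x) ->
  exists f, forall x, ball c (r / 2) x ->
    is_derive x dx f (P x) /\ is_derive x dy f (Q x).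
Proof.
move=> r0 sP sQ PQ.
set a := c.1 - r / 2; set u := c.1 + r / 2.
set b := c.2 - r / 2; set v := c.2 + r / 2.
have inB s t : a <= s <= u -> b <= t <= v -> ball c r (s, t).
  rewrite /a /u /b /v => /andP[? ?] /andP[? ?].
  by apply/ball_planeE; rewrite /= !ltr_norml; split; apply/andP; split; lra.
have K0 : compact (`[a, u] `*` `[b, v]).
  by apply: compact_setX; exact: segment_compact.
pose f x := \int[mu]_(s in `[a, x.1]) P (s, b) + \int[mu]_(s in `[b, x.2]) Q (x.1, s).
exists f => x /ball_planeE; rewrite !ltr_norml => -[/andP[x1 x2] /andP[x3 x4]].
have [xa xu] : a < x.1 /\ x.1 < u by rewrite /a /u; lra.
have [xb xv] : b < x.2 /\ x.2 < v by rewrite /b /v; lra.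
have cont g s t : smooth (ball c r) g -> a <= s <= u -> b <= t <= v ->
    {for (s, t), continuous g}.
  by move=> sg ? ?; apply: smooth_continuous sg _; exact: inB.
split; last first.
  apply/is_derive_line2; rewrite /f /= -[Q x]add0r [in Q x](surjective_pairing x).
  apply: is_deriveD.
  apply: (@is_derive_integral (fun s => Q (x.1, s)) b v); first lra.
  by move=> s ?; apply: continuous_slice2; apply: cont => //; lra.
apply/is_derive_line1; rewrite /f /=.
have -> : P x = P (x.1, b) + (P (x.1, x.2) - P (x.1, b)) by case: (x) => ? ?;
  rewrite addrC subrK.
apply: is_deriveD.
  apply: (@is_derive_integral (fun s => P (s, b)) a u); first lra.
  by move=> s ?; apply: continuous_slice1; apply: cont => //; lra.
have [M M0 HM] : exists2 M, 0 <= M & forall s t, a <= s <= u -> b <= t <= v ->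
    `|'D_dx Q (s, t)| <= M.
  have [|| z _ zM] := @compact_EVT_max _ R (fun y => `|'D_dx Q y|) _ _ K0.
  - by exists x; split=> /=; rewrite in_itv/=; lra.
  - apply: continuous_in_subspaceT => -[s t]; rewrite inE => -[/=].
    rewrite !in_itv/= => s1 t1.
    apply: (@continuous_comp _ _ _ ('D_dx Q) Num.norm).
      by apply: cont => //; exact: smooth_dx.
    exact: norm_continuous.
  - exists `|'D_dx Q z| => // s t s1 t1.
    by apply: (zM (s, t)); rewrite inE; split; rewrite /= in_itv.
have xI : `]a, u[%classic x.1 by rewrite /= in_itv/= xa xu.
have mB : measurable `[b, x.2]%classic by exact: measurable_itv.
have i1 : forall t, `]a, u[%classic t ->
   mu.-integrable `[b, x.2] (EFin \o (fun t s => Q (t, s)) t).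
  move=> t; rewrite /= in_itv/= => ?.
  apply: continuous_compact_integrable; first exact: segment_compact.
  apply: continuous_in_subspaceT => s; rewrite inE /= in_itv /= => ?.
  by apply: continuous_slice2; apply: cont => //; lra.
have dQ t s : `]a, u[%classic t -> `[b, x.2]%classic s ->
    is_derive t 1 (fun t => Q (t, s)) ('D_dx Q (t, s)).
  rewrite /= !in_itv/= => ? ?; apply/(is_derive_line1 Q (t, s)).
  have [|/derivableP//] := smooth_derivable sQ (x := (t, s)).
  by apply: inB; lra.
have d1 : forall t s, `]a, u[%classic t -> `[b, x.2]%classic s ->
   derivable ((fun t s => Q (t, s)) ^~ s) t 1.
  by move=> t s tI sI; have [] := dQ t s tI sI.
have dE t s : `]a, u[%classic t -> `[b, x.2]%classic s ->
  partial1of2 (fun t s => Q (t, s)) t s = 'D_dx Q (t, s).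
  by move=> tI sI; have [_ <-] := dQ t s tI sI; rewrite partial1of2E.
have iM : mu.-integrable `[b, x.2] (EFin \o (fun=> M)).
  apply: continuous_compact_integrable; first exact: segment_compact.
  by apply: continuous_subspaceT => s; exact: cvg_cst.
have GM : forall t s, `]a, u[%classic t -> `[b, x.2]%classic s ->
   `|partial1of2 (fun t s => Q (t, s)) t s| <= M.
  move=> t s tI sI; rewrite dE//; move: tI sI; rewrite /= !in_itv/= => ? ?.
  by apply: HM; lra.
have D := @derivable_under_integral R _ _ mu (fun t s =>
  Q (t, s)) _ mB _ _ _ xI i1 d1 _ (fun=> M0) iM GM.
apply: DeriveDef; first exact D.
rewrite -derive1E
  (@differentiation_under_integral R _ _ mu (fun t s =>
    Q (t, s)) _ mB _ _ _ xI i1 d1 _ (fun=> M0) iM GM).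
rewrite (@eq_Rintegral _ _ _ mu _ (fun s => 'D_dy P (x.1, s))); last first.
  move=> s; rewrite inE => sI; rewrite dE// PQ//.
  by move: sI; rewrite /= in_itv/= => ?; apply: inB; lra.
have H := @integral_derive (fun s => P (x.1, s)) (fun s => 'D_dy P (x.1, s)) b x.2 xb.
apply: H => s sI; have sB : ball c r (x.1, s) by apply: inB; lra.
split; last by apply: (@continuous_slice2 ('D_dy P));
  exact: (smooth_continuous (smooth_dy sP) sB).
apply/(is_derive_line2 P (x.1, s)).
by have [_ /derivableP] := smooth_derivable sP sB.
Qed.

End SchwarzPoincare.

(** * The inverse function theorem in the plane *)

Section InverseFunction.
Variable R : realType.
Implicit Types (A B W : set (plane R)) (f g h : plane R -> R) (x y z v w : plane R).

Lemma differentiable_plane_near f x e : differentiable f x -> 0 < e ->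
  \forall y \near x,
    `|f y - f x - ('D_dx f x * (y.1 - x.1) + 'D_dy f x * (y.2 - x.2))|
      <= e * `|y - x|.
Proof.
move=> df e0; have /diff_locallyP[_ /eqaddoP/(_ e e0)] := df.
rewrite -[X in X -> _]/(\forall h \near (0 : plane R),
  `|((f \o shift x) - (cst (f x) + 'd f x)) h| <= e * `|h|).
rewrite (near_shift x 0) => H; near=> y.
have : ((fun k : plane R =>
  `|((f \o shift x) - (cst (f x) + 'd f x)) k| <= e * `|k|) \o shift (0 - x)) y.
  by near: y.
rewrite /= sub0r; apply: le_trans; rewrite le_eqVlt; apply/orP; left; apply/eqP.
congr `| _ |; rewrite !fctE /= subrK -(deriveE _ df) (derive_partials (y - x))//=.
by move: ('D_dx f x) ('D_dy f x) => a b; ring.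
Unshelve. all: by end_near. Qed.

Lemma plane_eq x y : x = y <-> x.1 = y.1 /\ x.2 = y.2.
Proof. by case: x y => [a b] [a' b'] /=; split=> [[-> ->]|[-> ->]]. Qed.

(** By compactness some point is moved the least by the contraction; as its image is
    moved even less unless it is fixed, it is fixed. *)
Lemma square_fixpoint (c : plane R) (r : R) (T : plane R -> plane R) : 0 < r ->
  (forall x, `|c - x| <= r -> `|c - T x| <= r) ->
  (forall x y, `|c - x| <= r -> `|c - y| <= r ->
     `|T x - T y| <= 2^-1 * `|x - y|) ->
  exists2 x, `|c - x| <= r & T x = x.
Proof.
move=> r0 Tr TL.
set K := `[c.1 - r, c.1 + r] `*` `[c.2 - r, c.2 + r].
have KE x : K x <-> `|c - x| <= r.
  rewrite norm_plane ge_max /K /= !in_itv/= !ler_norml.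
  split=> [[/andP[? ?] /andP[? ?]]|/andP[/andP[? ?] /andP[? ?]]].
    by apply/andP; split; apply/andP; split; lra.
  by split; apply/andP; split; lra.
have cK : compact K by apply: compact_setX; exact: segment_compact.
have cc : K c by apply/KE; rewrite subrr normr0 ltW.
have [|| x /[!inE] Kx xmin] := @compact_EVT_min _ R (fun x => `|x - T x|) K _ cK.
- by exists c.
- apply/subspace_continuousP => x Kx.
  apply: (@cvg_norm _ _ _ _ _ (fun y => y - T y)); apply: cvgB.
    by apply: cvg_within.
  apply/cvgrPdist_lt => e e0; rewrite near_withinE; near=> y => Ky.
  apply: le_lt_trans (TL _ _ _ _) _; [exact/KE..|].
  have : `|x - y| < e by near: y; apply/near_ballP; exists e => // y /ball_normE_plane.
  have := normr_ge0 (x - y); lra.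
exists x; first exact/KE.
apply/eqP; rewrite eq_sym -subr_eq0 -normr_eq0.
have KT : K (T x) by apply/KE/Tr/KE.
have h1 := xmin (T x) ltac:(by rewrite inE).
have h2 : `|T x - T (T x)| <= 2^-1 * `|x - T x| by apply: TL; exact/KE.
have := normr_ge0 (x - T x); rewrite eq_le normr_ge0 andbT; lra.
Unshelve. all: by end_near. Qed.

(** Two partial derivatives bounded by 1/4 give, in the maximum norm, the Lipschitz
    constant 1/2. *)
Lemma small_partials_lipschitz f (c : plane R) r :
  (forall w, ball c r w -> derivable f w dx /\ derivable f w dy) ->
  (forall w, ball c r w -> `|'D_dx f w| <= 4^-1 /\ `|'D_dy f w| <= 4^-1) ->
  forall x y, ball c r x -> ball c r y -> `|f x - f y| <= 2^-1 * `|x - y|.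
Proof.
move=> df Df x y cx cy.
have [w [w' [/Df[W _] /Df[_ W'] ->]]] := MVT_plane df cx cy.
apply: le_trans (ler_normD _ _) _; rewrite !normrM.
have h1 := ler_pM (normr_ge0 _) (normr_ge0 _) W (ler_norm_fst (x - y)).
have h2 := ler_pM (normr_ge0 _) (normr_ge0 _) W' (ler_norm_snd (x - y)).
move: h1 h2 => /=; lra.
Qed.

(** Near [c], a smooth map [H] tangent to the identity at [c] differs from the
    identity by a contraction of ratio 1/2. So [H] expands distances by at least
    1/2, and [H x = y] is solved as the fixed point of [x |-> x - H x + y]. *)
Lemma inverse_function_id A (H1 H2 : plane R -> R) (c : plane R) :
  open A -> A c -> smooth A H1 -> smooth A H2 ->
  'D_dx H1 c = 1 -> 'D_dy H1 c = 0 -> 'D_dx H2 c = 0 -> 'D_dy H2 c = 1 ->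
  let H x := (H1 x, H2 x) in
  exists2 r, 0 < r & [/\ ball c r `<=` A,
    forall x y, ball c r x -> ball c r y -> `|x - y| <= 2 * `|H x - H y| &
    forall y, ball (H c) (r / 4) y -> exists2 x, ball c r x & H x = y].
Proof.
move=> oA Ac s1 s2 d11 d12 d21 d22 H.
pose k1 x := x.1 - H1 x; pose k2 x := x.2 - H2 x.
have sk1 : smooth A k1 by apply: smooth_sub_fun => //; exact: smooth_fst.
have sk2 : smooth A k2 by apply: smooth_sub_fun => //; exact: smooth_snd.
have dk1 v : 'D_v k1 c = v.1 - 'D_v H1 c.
  have [d <-] := derive_fst c v.
  rewrite -deriveB//; first exact: diff_derivable.
  exact/diff_derivable/(smooth_differentiable oA s1 Ac).
have dk2 v : 'D_v k2 c = v.2 - 'D_v H2 c.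
  have [d <-] := derive_snd c v.
  rewrite -deriveB//; first exact: diff_derivable.
  exact/diff_derivable/(smooth_differentiable oA s2 Ac).
have small g : smooth A g -> g c = 0 -> \forall w \near c, `|g w| <= 4^-1.
  move=> sg gc; have := smooth_continuous sg Ac.
  move=> /cvgrPdist_le/(_ 4^-1); rewrite gc => H'.
  have : \forall t \near c, `|0 - g t| <= 4^-1 by apply: H'; rewrite invr_gt0.
  by apply: filterS => w; rewrite sub0r normrN.
have /near_ballP[r r0 rB] : \forall w \near c, [/\ A w,
   `|'D_dx k1 w| <= 4^-1 /\ `|'D_dy k1 w| <= 4^-1 &
   `|'D_dx k2 w| <= 4^-1 /\ `|'D_dy k2 w| <= 4^-1].
  have N11 : \forall w \near c, `|'D_dx k1 w| <= 4^-1.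
    by apply: small (smooth_dx sk1) _; rewrite dk1 d11 /= subrr.
  have N12 : \forall w \near c, `|'D_dy k1 w| <= 4^-1.
    by apply: small (smooth_dy sk1) _; rewrite dk1 d12 /= subrr.
  have N21 : \forall w \near c, `|'D_dx k2 w| <= 4^-1.
    by apply: small (smooth_dx sk2) _; rewrite dk2 d21 /= subrr.
  have N22 : \forall w \near c, `|'D_dy k2 w| <= 4^-1.
    by apply: small (smooth_dy sk2) _; rewrite dk2 d22 /= subrr.
  exact: filterS3 (near_open oA Ac) (filterI N11 N12) (filterI N21 N22).
have L x y : ball c r x -> ball c r y ->
    `|(x - H x) - (y - H y)| <= 2^-1 * `|x - y|.
  move=> cx cy; rewrite [X in X <= _]norm_plane ge_max; apply/andP; split.
    apply: (@small_partials_lipschitz k1 c r) => // w /rB[Aw ? _] //.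
    exact: smooth_derivable Aw.
  apply: (@small_partials_lipschitz k2 c r) => // w /rB[Aw _ ?] //.
  exact: smooth_derivable Aw.
exists r => //; split.
- by move=> x /rB[].
- move=> x y cx cy; have := L x y cx cy.
  have -> : x - H x - (y - H y) = (x - y) - (H x - H y).
    by apply/plane_eq; split=> /=; ring.
  have := lerB_dist (x - y) (H x - H y).
  by move: (`| _ |) (`| _ |) (`| _ |) => a b d; lra.
- move=> y /ball_normE_plane cy.
  have sub x : `|c - x| <= r / 2 -> ball c r x.
    by move=> cx; apply/ball_normE_plane; apply: le_lt_trans cx _; lra.
  have [| | |x cx E] := @square_fixpoint c (r / 2) (fun x => x - H x + y).
  + lra.
  + move=> x cx.
    have -> : c - (x - H x + y) = (c - H c - (x - H x)) + (H c - y).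
      by apply/plane_eq; split=> /=; ring.
    apply: le_trans (ler_normD _ _) _.
    have := L c x (ballxx c r0) (sub x cx).
    move: cx cy r0; move: (`| _ |) (`| _ |) (`| _ |) => {sub L rB} a b d; lra.
  + move=> x z cx cz; have := L x z (sub x cx) (sub z cz).
    by have -> : x - H x + y - (z - H z + y) = x - H x - (z - H z)
      by apply/plane_eq; split=> /=; ring.
  exists x; first exact: sub.
  by apply: (addrI (x - H x)); rewrite E subrK.
Qed.

End InverseFunction.

Section InverseFunctionTheorem.
Variable R : realType.
Implicit Types (A B W : set (plane R)) (f g h : plane R -> R) (x y z v w : plane R).

Lemma open_square (c : plane R) (r : R) : open (ball c r).
Proof.
rewrite openE => y /ball_normE_plane cy; apply/near_ballP.
exists (r - `|c - y|); first by rewrite subr_gt0.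
move=> z /ball_normE_plane yz; apply/ball_normE_plane.
by apply: le_lt_trans (ler_distD y c z) _; rewrite addrC -ltrBrDr.
Qed.

Definition pd_jacobian f g x := 'D_dx f x * 'D_dy g x - 'D_dy f x * 'D_dx g x.

Lemma smooth_pd_jacobian A f g : open A -> smooth A f -> smooth A g ->
  smooth A (pd_jacobian f g).
Proof.
move=> oA sf sg; exact: (smooth_sub_fun oA
  (smooth_mul oA (smooth_dx sf) (smooth_dy sg))
  (smooth_mul oA (smooth_dy sf) (smooth_dx sg))).
Qed.

(** Since [G] is Lipschitz, the error in the linearisation of [F] at [x] is also
    negligible in terms of the distance between the images, so the differential of
    [F] can be inverted up to a negligible error. *)
Lemma derive_inverse W (F1 F2 : plane R -> R) (G : plane R -> plane R) (C : R) :
  let F x := (F1 x, F2 x) in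
  open W -> smooth W F1 -> smooth W F2 -> open (F @` W) -> 0 < C ->
  (forall x, W x -> G (F x) = x) ->
  (forall x y, W x -> W y -> `|x - y| <= C * `|F x - F y|) ->
  forall x, W x -> pd_jacobian F1 F2 x != 0 ->
  [/\ differentiable (fst \o G) (F x),
      'D_dx (fst \o G) (F x) = 'D_dy F2 x / pd_jacobian F1 F2 x &
      'D_dy (fst \o G) (F x) = - 'D_dy F1 x / pd_jacobian F1 F2 x] /\
  [/\ differentiable (snd \o G) (F x),
      'D_dx (snd \o G) (F x) = - 'D_dx F2 x / pd_jacobian F1 F2 x &
      'D_dy (snd \o G) (F x) = 'D_dx F1 x / pd_jacobian F1 F2 x].
Proof.
move=> F oW s1 s2 oV C0 GF FC x Wx.
have d1 := smooth_differentiable oW s1 Wx.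
have d2 := smooth_differentiable oW s2 Wx.
have GC y : (F @` W) y -> `|G y - x| <= C * `|y - F x| /\ F (G y) = y.
  by move=> [w Ww <-]; rewrite GF//; split => //; exact: FC.
rewrite /pd_jacobian.
have E1 := differentiable_plane_near d1; have E2 := differentiable_plane_near d2.
move: ('D_dx F1 x) ('D_dy F1 x) ('D_dx F2 x) ('D_dy F2 x) E1 E2 => a b c d E1 E2 J0.
set J := a * d - b * c in J0 *.
have VFx : (F @` W) (F x) by exists x.
(* An error [e1, e2] in the linearisation of [F] becomes the error
   [p * e1 + q * e2] in that of the component [pr] of [G]. *)
have key (p q : R) (pr : plane R -> R) :
    (forall y, pr (G y) - pr x - (p * (F1 (G y) - F1 x) + q * (F2 (G y) - F2 x)) =
       - (p * (F1 (G y) - F1 x - (a * ((G y).1 - x.1) + b * ((G y).2 - x.2)))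
       + q * (F2 (G y) - F2 x - (c * ((G y).1 - x.1) + d * ((G y).2 - x.2))))) ->
    [/\ differentiable (pr \o G) (F x), 'D_dx (pr \o G) (F x) = p &
        'D_dy (pr \o G) (F x) = q].
  move=> Hpr; apply: differentiable_plane => e e0.
  set m := `|p| + `|q| + 1.
  have m0 : 0 < m by rewrite /m; have := normr_ge0 p; have := normr_ge0 q; lra.
  have e'0 : 0 < e / (m * C) by rewrite divr_gt0// mulr_gt0.
  have /near_ballP[r r0 rB] : \forall y \near x,
      `|F1 y - F1 x - (a * (y.1 - x.1) + b * (y.2 - x.2))| <= e / (m * C) * `|y - x| /\
      `|F2 y - F2 x - (c * (y.1 - x.1) + d * (y.2 - x.2))| <= e / (m * C) * `|y - x|.
    exact: (filterI (E1 _ e'0) (E2 _ e'0)).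
  have rC0 : 0 < r / C by rewrite divr_gt0.
  have NB := nbhsx_ballx (F x) _ rC0.
  apply: filterS2 (near_open oV VFx) NB => y Vy Fy.
  have [yC FG] := GC y Vy.
  have rG : ball x r (G y).
    apply/ball_normE_plane; rewrite distrC; apply: le_lt_trans yC _.
    by rewrite mulrC -ltr_pdivlMr// distrC; exact/ball_normE_plane.
  have [/= R1 R2] := rB _ rG.
  have -> : y.1 = F1 (G y) by rewrite -[in LHS]FG.
  have -> : y.2 = F2 (G y) by rewrite -[in LHS]FG.
  rewrite /= GF// Hpr normrN; apply: le_trans (ler_normD _ _) _; rewrite !normrM.
  have h1 := ler_wpM2l (normr_ge0 p) R1.
  have h2 := ler_wpM2l (normr_ge0 q) R2.
  apply: (le_trans (lerD h1 h2)); rewrite -mulrDl.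
  apply: (@le_trans _ _ (m * (e / (m * C) * (C * `|y - F x|)))).
    have pqm : `|p| + `|q| <= m by rewrite /m lerDl.
    apply: (ler_pM _ _ pqm); first exact: addr_ge0.
      by rewrite mulr_ge0// ltW.
    by rewrite ler_wpM2l// ltW.
  rewrite le_eqVlt; apply/orP; left; apply/eqP; field.
  by rewrite !gt_eqF.
have J1 : d / J * a - b / J * c = 1 by rewrite /J; field.
split.
  apply: key => y; move: (F1 (G y) - F1 x) (F2 (G y) - F2 x) => p q.
  by rewrite /J; field.
apply: key => y; move: (F1 (G y) - F1 x) (F2 (G y) - F2 x) => p q.
by rewrite /J; field.
Qed.

(** The partial derivatives of [h \o G] are again of the form [h' \o G] with [h']
    smooth on [W], which gives all orders by induction. *)
Lemma smooth_inverse W (F1 F2 : plane R -> R) (G : plane R -> plane R) (C : R) h :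
  let F x := (F1 x, F2 x) in
  open W -> smooth W F1 -> smooth W F2 -> open (F @` W) -> 0 < C ->
  (forall x, W x -> G (F x) = x) ->
  (forall x y, W x -> W y -> `|x - y| <= C * `|F x - F y|) ->
  (forall x, W x -> pd_jacobian F1 F2 x != 0) ->
  smooth W h -> smooth (F @` W) (h \o G).
Proof.
move=> F oW s1 s2 oV C0 GF FC J0.
have D f v x : smooth W f -> W x -> differentiable (f \o G) (F x) /\
   'D_v (f \o G) (F x) =
     'D_dx f x * 'D_v (fst \o G) (F x) + 'D_dy f x * 'D_v (snd \o G) (F x).
  move=> sf Wx.
  have [[g1 _ _] [g2 _ _]] := derive_inverse oW s1 s2 oV C0 GF FC Wx (J0 x Wx).
  have df := smooth_differentiable oW sf Wx.
  have -> : f \o G = (fun y => f ((fst \o G) y, (snd \o G) y)).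
    by apply/funext => y /=; rewrite -surjective_pairing.
  have EG : ((fst \o G) (F x), (snd \o G) (F x)) = x.
    by rewrite /= GF// -surjective_pairing.
  have := @derive_comp_plane R f (fst \o G) (snd \o G) (F x) v.
  by rewrite EG; apply.
move=> sh n; elim: n h sh => [|n IH] h sh.
  by move=> _ [x Wx <-]; exact: (differentiable_continuous (D h 0 x sh Wx).1).
have [J1 [sx sy]] := (smooth_pd_jacobian oW s1 s2, (smooth_dx sh, smooth_dy sh)).
pose hx x := ('D_dx h x * 'D_dy F2 x - 'D_dy h x * 'D_dx F2 x) / pd_jacobian F1 F2 x.
pose hy x := ('D_dy h x * 'D_dx F1 x - 'D_dx h x * 'D_dy F1 x) / pd_jacobian F1 F2 x.
have shx : smooth W hx.
  exact: (smooth_div oW (smooth_sub_fun oW (smooth_mul oW sx (smooth_dy s2))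
    (smooth_mul oW sy (smooth_dx s2))) J1 J0).
have shy : smooth W hy.
  exact: (smooth_div oW (smooth_sub_fun oW (smooth_mul oW sy (smooth_dx s1))
    (smooth_mul oW sx (smooth_dy s1))) J1 J0).
apply: (class_C_step oV _ (IH _ shx) (IH _ shy)) => _ [x Wx <-].
have [[_ g11 g12] [_ g21 g22]] := derive_inverse oW s1 s2 oV C0 GF FC Wx (J0 x Wx).
have [d Ex] := D h dx x sh Wx; have [_ Ey] := D h dy x sh Wx.
split; first exact: d.
- by rewrite Ex /F g11 g21 /= GF// /hx; ring.
- by rewrite Ey /F g12 g22 /= GF// /hy; ring.
Qed.

(** Inverse function theorem. Composing with the inverse of the differential at
    [x0] reduces it to a map tangent to the identity. The neighbourhood [W] is
    chosen with a square as image, over which a function with vanishing derivative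
    in the second coordinate depends on the first only. *)
Lemma inverse_function A (F1 F2 : plane R -> R) (x0 : plane R) :
  let F x := (F1 x, F2 x) in
  open A -> A x0 -> smooth A F1 -> smooth A F2 -> pd_jacobian F1 F2 x0 != 0 ->
  exists (W : set (plane R)) (G : plane R -> plane R) (s : R),
  [/\ open W, W x0, W `<=` A, 0 < s & F @` W = ball (F x0) s] /\
  (forall x, W x -> G (F x) = x) /\
  (forall h, smooth W h -> smooth (F @` W) (h \o G)).
Proof.
move=> F oA Ax0 s1 s2 J0.
have sJ := smooth_pd_jacobian oA s1 s2.
have cJ := smooth_continuous sJ Ax0.
have NJ : \forall x \near x0, A x /\ pd_jacobian F1 F2 x != 0.
  apply: filterI; first exact: near_open.
  exact: (cvgr_neq0 _ cJ J0).
have /near_ballP[r0 r00 r0B] := NJ.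
have d1 := smooth_differentiable oA s1 Ax0.
have d2 := smooth_differentiable oA s2 Ax0.
have HL (p q : R) : smooth A (fun x => p * F1 x + q * F2 x) /\
   forall v, 'D_v (fun x => p * F1 x + q * F2 x) x0 =
     p * 'D_v F1 x0 + q * 'D_v F2 x0.
  split=> [|v].
    by apply: smooth_add => //; apply: smooth_mul => //; exact: smooth_cst.
  have D1 : derivable F1 x0 v by exact: diff_derivable.
  have D2 : derivable F2 x0 v by exact: diff_derivable.
  have -> : (fun x => p * F1 x + q * F2 x) = (p *: F1) + (q *: F2) by [].
  rewrite deriveD; [|exact: derivableZ..].
  by rewrite (deriveZ p D1) (deriveZ q D2).
move: J0; rewrite /pd_jacobian.
move Ea : ('D_dx F1 x0) => a; move Eb : ('D_dy F1 x0) => b.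
move Ec : ('D_dx F2 x0) => c; move Ed : ('D_dy F2 x0) => d J0.
set J := a * d - b * c in J0 *.
have [sH1 dH1] := HL (d / J) (- b / J); have [sH2 dH2] := HL (- c / J) (a / J).
set H1 := (fun x => _) in sH1 dH1; set H2 := (fun x => _) in sH2 dH2.
have oB := @open_square x0 r0.
have BA : ball x0 r0 `<=` A by move=> x /r0B[].
have [||||r r1 [rA Lip surj]] := inverse_function_id oB (ballxx x0 r00)
  (smooth_sub BA sH1) (smooth_sub BA sH2).
- by rewrite dH1 Ea Ec /J; field.
- by rewrite dH1 Eb Ed /J; field.
- by rewrite dH2 Ea Ec /J; field.
- by rewrite dH2 Eb Ed /J; field.
set m := `|d / J| + `|- b / J| + `|- c / J| + `|a / J| + 1.
have m0 : 0 < m.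
  by rewrite /m ltr_wpDl// !addr_ge0.
have combm p q z w : `|p| + `|q| <= m ->
    `|(p * z.1 + q * z.2) - (p * w.1 + q * w.2)| <= m * `|z - w|.
  move=> pqm.
  have -> : (p * z.1 + q * z.2) - (p * w.1 + q * w.2) =
    p * (z - w).1 + q * (z - w).2 by rewrite /=; ring.
  apply: le_trans (ler_normD _ _) _; rewrite !normrM.
  have h1 := ler_wpM2l (normr_ge0 p) (ler_norm_fst (z - w)).
  have h2 := ler_wpM2l (normr_ge0 q) (ler_norm_snd (z - w)).
  apply: (le_trans (lerD h1 h2)); rewrite -mulrDl.
  exact: ler_wpM2r.
pose Linv z := (d / J * z.1 + - b / J * z.2, - c / J * z.1 + a / J * z.2).
have Linvm z w : `|Linv z - Linv w| <= m * `|z - w|.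
  have n1 := normr_ge0 (d / J); have n2 := normr_ge0 (- b / J).
  have n3 := normr_ge0 (- c / J); have n4 := normr_ge0 (a / J).
  rewrite [X in X <= _]norm_plane ge_max; apply/andP; split; apply: combm.
    by rewrite /m -!addrA lerD2l lerDl !addr_ge0.
  by rewrite /m [X in _ <= X + 1]addrAC -addrA [X in _ <= X]addrC; lra.
have HLinv x : (H1 x, H2 x) = Linv (F x) by [].
have Linv_inj z w : Linv z = Linv w -> z = w.
  move=> [e1 e2]; apply/plane_eq; split.
  - have -> : z.1 = a * (d / J * z.1 + - b / J * z.2) + b * (- c / J * z.1 + a / J *
    z.2).
      by rewrite /J; field.
    by rewrite e1 e2 /J; field.
  - have -> : z.2 = c * (d / J * z.1 + - b / J * z.2) + d * (- c / J * z.1 + a / J *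
    z.2).
      by rewrite /J; field.
    by rewrite e1 e2 /J; field.
have FC x y : ball x0 r x -> ball x0 r y -> `|x - y| <= (2 * m) * `|F x - F y|.
  move=> bx by'; apply: le_trans (Lip x y bx by') _.
  by rewrite !HLinv -mulrA ler_wpM2l.
set s := r / 4 / m.
have s0 : 0 < s by rewrite !divr_gt0.
pose W := ball x0 r `&` (F @^-1` ball (F x0) s).
have rA' x : ball x0 r x -> A x by move=> /rA /BA.
have oW : open W.
  rewrite openE => x [bx Fx].
  have c1 := smooth_continuous s1 (rA' x bx).
  have c2 := smooth_continuous s2 (rA' x bx).
  have cF : F y @[y --> x] --> F x by exact: cvg_pair c1 c2.
  apply: filterI; first exact: (near_open (@open_square x0 r) bx).
  exact: cF (near_open (@open_square (F x0) s) Fx).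
have FW : F @` W = ball (F x0) s.
  apply/seteqP; split=> [_ [x [_ ?] <-]//|z zs].
  have [|x bx Hx] := surj (Linv z).
    apply/ball_normE_plane; rewrite HLinv; apply: le_lt_trans (Linvm _ _) _.
    by rewrite mulrC -ltr_pdivlMr//; exact/ball_normE_plane.
  have Fx : F x = z by apply: Linv_inj.
  by exists x => //; split; rewrite ?Fx //= Fx.
pose G z := xget x0 [set x | W x /\ F x = z].
have GF x : W x -> G (F x) = x.
  move=> Wx; have [[bG _] E] : W (G (F x)) /\ F (G (F x)) = F x.
    by apply: (@xgetPex _ x0 [set y | W y /\ F y = F x]); exists x.
  apply/eqP; rewrite -subr_eq0 -normr_le0.
  by have := FC _ x bG Wx.1; rewrite E subrr normr0 mulr0.
have m20 : 0 < 2 * m by rewrite mulr_gt0.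
exists W, G, s; split; first split=> //.
- by split; exact: ballxx.
- by move=> x [/rA'].
split=> // h sh; apply: (@smooth_inverse W F1 F2 G (2 * m)) => //.
- by apply: smooth_sub s1 => x [/rA'].
- by apply: smooth_sub s2 => x [/rA'].
- by rewrite -/F FW; exact: open_square.
- by move=> x y [bx _] [by' _]; exact: FC.
- by move=> x [/rA/r0B[]].
Qed.

End InverseFunctionTheorem.

(** * Functions and vector fields on a surface *)

Section SurfaceCalculus.
Variables (R : realType) (M : oriented_surface R).
Implicit Types (A B : set M) (f h : M -> R) (p q : M) (k l : chart R M).
Implicit Types (X Y V W : M -> plane R).

(** Open sets are carried to open sets because the inverse of a chart is
    continuous on its open image. *)
Lemma chart_image_setI_open k A : open A ->
  open (chart_map k @` (chart_dom k `&` A)).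
Proof.
move=> oA; rewrite openE => _ [p [kp Ap] <-].
have Ux : (chart_map k @` chart_dom k) (chart_map k p) by exists p.
have cI := chart_inv_continuous Ux.
have N1 := near_open (@chart_image_open _ _ k) Ux.
have N2 : \forall y \near chart_map k p, A (chart_inv k y).
  by apply: cI; rewrite chart_mapK//; exact: open_nbhs_nbhs.
apply: filterS2 N1 N2 => _ [q kq <-]; rewrite chart_mapK// => Aq.
by exists q.
Qed.

Lemma overlap_open k l : open (overlap k l).
Proof. exact/chart_image_setI_open/chart_dom_open. Qed.

Lemma smooth_on_sub A B f : B `<=` A -> smooth_on A f -> smooth_on B f.
Proof. by move=> BA sf q; apply: smooth_sub (sf q) => _ [p [? /BA ?] <-]; exists p. Qed.

Lemma smooth_on_local A f :
  (forall p, A p -> exists B, [/\ open B, B p & smooth_on B f]) -> smooth_on A f.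
Proof.
move=> H q; apply: smooth_local => _ [p [qp Ap] <-].
have [B [_ Bp sf]] := H p Ap.
by exists (chart_map (chart_at q) @` (chart_dom (chart_at q) `&` B)) => //; exists p.
Qed.

Lemma smooth_on_eq A f h : open A -> (forall p, A p -> f p = h p) ->
  smooth_on A f -> smooth_on A h.
Proof.
move=> oA fh sf q; apply: smooth_eq (sf q); first exact: chart_image_setI_open.
by move=> _ [p [qp Ap] <-] /=; rewrite chart_mapK// fh.
Qed.

Lemma smooth_on_cst A (c : R) : open A -> smooth_on A (fun=> c).
Proof. by move=> oA q; apply: smooth_cst; exact: chart_image_setI_open. Qed.

Lemma smooth_on_add A f h : open A -> smooth_on A f -> smooth_on A h ->
  smooth_on A (fun p => f p + h p).
Proof.
move=> oA sf sh q; apply: (smooth_add _ (sf q) (sh q)).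
exact: chart_image_setI_open.
Qed.

Lemma smooth_on_sub_fun A f h : open A -> smooth_on A f -> smooth_on A h ->
  smooth_on A (fun p => f p - h p).
Proof.
move=> oA sf sh q; apply: (smooth_sub_fun _ (sf q) (sh q)).
exact: chart_image_setI_open.
Qed.

Lemma smooth_on_mul A f h : open A -> smooth_on A f -> smooth_on A h ->
  smooth_on A (fun p => f p * h p).
Proof.
move=> oA sf sh q; apply: (smooth_mul _ (sf q) (sh q)).
exact: chart_image_setI_open.
Qed.

Lemma smooth_on_div A f h : open A -> smooth_on A f ->
  smooth_on A h -> (forall p, A p -> h p != 0) -> smooth_on A (fun p => f p / h p).
Proof.
move=> oA sf sh h0 q; apply: (smooth_div _ (sf q) (sh q)).
  exact: chart_image_setI_open.
by move=> _ [p [qp Ap] <-] /=; rewrite chart_mapK// h0.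
Qed.

Lemma smooth_on_opp A f : open A -> smooth_on A f -> smooth_on A (fun p => - f p).
Proof.
move=> oA sf q; apply: (smooth_opp _ (sf q)); exact: chart_image_setI_open.
Qed.

Lemma smooth_on_expR A f : open A -> smooth_on A f ->
  smooth_on A (fun p => expR (f p)).
Proof.
move=> oA sf q; apply: (smooth_expR _ (sf q)); exact: chart_image_setI_open.
Qed.

Lemma smooth_on_ln A f : open A -> smooth_on A f -> (forall p, A p -> 0 < f p) ->
  smooth_on A (fun p => ln (f p)).
Proof.
move=> oA sf f0 q; apply: (smooth_ln _ (sf q)); first exact: chart_image_setI_open.
by move=> _ [p [qp Ap] <-] /=; rewrite chart_mapK// f0.
Qed.

Lemma smooth_fun_atlas f :
  (forall q, smooth_on (chart_dom (chart_at q)) f) -> smooth_fun f.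
Proof.
move=> sf; apply: smooth_on_local => p _; exists (chart_dom (chart_at p)); split=> //.
  exact: chart_dom_open.
exact: mem_chart_at.
Qed.

Lemma local_coordinates_atlas q : local_coordinates (chart_at q).
Proof. by move=> p; split; exact: atlas_smooth. Qed.

(** Smoothness is defined in the charts of the atlas; it holds in all local
    coordinates, which differ from those by smooth transitions. *)
Lemma smooth_on_chart k A f : local_coordinates k -> open A -> smooth_on A f ->
  smooth (chart_map k @` (chart_dom k `&` A)) (f \o chart_inv k).
Proof.
move=> lk oA sf; apply: smooth_local => _ [p [kp Ap] <-].
set q := p; pose B := chart_dom k `&` (A `&` chart_dom (chart_at q)).
have oB : open (chart_map k @` B).
  by apply: chart_image_setI_open; exact/openI/chart_dom_open.
exists (chart_map k @` B); first by exists p => //; split=> //; split=> //;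
  exact: mem_chart_at.
have [sT _] := lk q.
have sub : chart_map k @` B `<=` overlap k (chart_at q).
  by move=> _ [p' [? [? ?]] <-]; exists p'.
have S := @smooth_comp R _ _ (f \o chart_inv (chart_at q)) (fst \o transition k
  (chart_at q))
  (snd \o transition k (chart_at q)) oB (@chart_image_setI_open (chart_at q) A oA)
  (smooth_sub sub sT.1) (smooth_sub sub sT.2) _ (sf q).
apply: (smooth_eq oB _ (S _)).
  move=> _ [p' [kp' [Ap' qp']] <-].
  by rewrite /= /transition /= chart_mapK// -surjective_pairing chart_mapK.
move=> _ [p' [kp' [Ap' qp']] <-]; exists p' => //.
by rewrite /= /transition /= chart_mapK// -surjective_pairing.
Qed.

Lemma smooth_on_coord k : local_coordinates k ->
  smooth_on (chart_dom k) (fst \o chart_map k) /\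
  smooth_on (chart_dom k) (snd \o chart_map k).
Proof. by move=> lk; split=> q; have [_ []] := lk q. Qed.

(** [differential f p] is a derivative in the distinguished chart at [p], so this
    is the sense in which [f] is differentiable at [p]. *)
Definition diff_at f p :=
  differentiable (f \o chart_inv (chart_at p)) (chart_map (chart_at p) p).

Lemma smooth_on_diff_at A f p : open A -> smooth_on A f -> A p -> diff_at f p.
Proof.
move=> oA sf Ap.
apply: (smooth_differentiable (@chart_image_setI_open (chart_at p) A oA) (sf p)).
by exists p => //; split=> //; exact: mem_chart_at.
Qed.

Lemma near_chart k A p : open A -> chart_dom k p -> A p ->
  \forall y \near chart_map k p, (chart_map k @` (chart_dom k `&` A)) y.
Proof.
by move=> oA kp Ap; apply: near_open; [exact: chart_image_setI_open|exists p].
Qed.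

Lemma differential_eq A f h p v : open A -> A p -> (forall q, A q -> f q = h q) ->
  differential f p v = differential h p v.
Proof.
move=> oA Ap fh; apply: near_eq_derive.
apply: filterS (near_chart oA (mem_chart_at p) Ap) => _ [q [pq Aq] <-] /=.
by rewrite chart_mapK// fh.
Qed.

Lemma differential_linear f p (a b : R) v w : diff_at f p ->
  differential f p (a *: v + b *: w) = a * differential f p v + b * differential f p w.
Proof.
by move=> df; rewrite /differential !deriveE// linearD !linearZ.
Qed.

(** Chain rule for the change of coordinates from the distinguished chart at [p]
    to the chart [k]. *)
Lemma differential_chart k f p v : local_coordinates k -> chart_dom k p ->
  differentiable (f \o chart_inv k) (chart_map k p) ->
  differential f p v =
    'D_dx (f \o chart_inv k) (chart_map k p) * differential (fst \o chart_map k) p v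
  + 'D_dy (f \o chart_inv k) (chart_map k p) * differential (snd \o chart_map k) p v.
Proof.
move=> lk kp df.
have ok := @chart_dom_open _ _ k.
have [su sv] := smooth_on_coord lk.
have du := smooth_on_diff_at ok su kp; have dv := smooth_on_diff_at ok sv kp.
set x := chart_map (chart_at p) p.
have px : chart_inv (chart_at p) x = p by rewrite chart_mapK//; exact: mem_chart_at.
have := @derive_comp_plane R (f \o chart_inv k) (fst \o chart_map k \o chart_inv
  (chart_at p))
  (snd \o chart_map k \o chart_inv (chart_at p)) x v.
rewrite /= px -surjective_pairing => /(_ df du dv)[_ <-].
apply: near_eq_derive.
apply: filterS (near_chart ok (mem_chart_at p) kp) => _ [q [pq kq] <-] /=.
by rewrite (chart_mapK pq) -surjective_pairing chart_mapK.
Qed.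

Lemma differential_coord_self p v :
  differential (fst \o chart_map (chart_at p)) p v = v.1 /\
  differential (snd \o chart_map (chart_at p)) p v = v.2.
Proof.
have N := near_chart (@chart_dom_open _ _ (chart_at p)) (mem_chart_at p)
  (mem_chart_at p).
split.
- have [_ <-] := derive_fst (chart_map (chart_at p) p) v.
  by apply: near_eq_derive; apply: filterS N => _ [q [pq _] <-] /=; rewrite chart_mapK.
- have [_ <-] := derive_snd (chart_map (chart_at p) p) v.
  by apply: near_eq_derive; apply: filterS N => _ [q [pq _] <-] /=; rewrite chart_mapK.
Qed.

Lemma actD X f h p : diff_at f p -> diff_at h p ->
  act X (fun q => f q + h q) p = act X f p + act X h p.
Proof.
move=> df dh; rewrite /act /differential.
by rewrite -(deriveD (diff_derivable df) (diff_derivable dh)).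
Qed.

Lemma actM X f h p : diff_at f p -> diff_at h p ->
  act X (fun q => f q * h q) p = f p * act X h p + h p * act X f p.
Proof.
move=> df dh; rewrite /act /differential.
have := deriveM (diff_derivable (v := X p) df) (diff_derivable (v := X p) dh).
by rewrite /GRing.scale /= chart_mapK//; exact: mem_chart_at.
Qed.

Lemma act_comp X (t : R -> R) (d : R) f p : diff_at f p -> is_derive (f p) 1 t d ->
  act X (fun q => t (f q)) p = d * act X f p.
Proof.
move=> df dt; rewrite /act /differential.
apply: (derive_comp_real _ df _).2.
by rewrite /= chart_mapK//; exact: mem_chart_at.
Qed.

Lemma act_cst X (c : R) p : act X (fun=> c) p = 0.
Proof. exact: derive_cst. Qed.

Lemma act_eq X A f h p : open A -> A p -> (forall q, A q -> f q = h q) ->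
  act X f p = act X h p.
Proof. by move=> oA Ap fh; exact: (@differential_eq A). Qed.

Lemma act_chart k X f p : local_coordinates k -> chart_dom k p ->
  differentiable (f \o chart_inv k) (chart_map k p) ->
  act X f p =
    'D_dx (f \o chart_inv k) (chart_map k p) * act X (fst \o chart_map k) p
  + 'D_dy (f \o chart_inv k) (chart_map k p) * act X (snd \o chart_map k) p.
Proof. exact: differential_chart. Qed.

Lemma smooth_act A X f : open A -> smooth_field X -> smooth_on A f ->
  smooth_on A (act X f).
Proof.
move=> oA sX sf q.
have oI := @chart_image_setI_open (chart_at q) A oA.
have sub : chart_map (chart_at q) @` (chart_dom (chart_at q) `&` A) `<=`
  chart_map (chart_at q) @` (chart_dom (chart_at q) `&` chart_dom (chart_at q)).
  by move=> _ [p [? ?] <-]; exists p.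
have [sXu sXv] := sX q.
apply: (smooth_eq oI _ (smooth_add oI
  (smooth_mul oI (smooth_dx (sf q)) (smooth_sub sub (sXu q)))
  (smooth_mul oI (smooth_dy (sf q)) (smooth_sub sub (sXv q))))).
move=> _ [p [qp Ap] <-] /=; rewrite chart_mapK//.
have D : differentiable (f \o chart_inv (chart_at q)) (chart_map (chart_at q) p).
  by apply: (smooth_differentiable oI (sf q)); exists p.
by rewrite (act_chart X (@local_coordinates_atlas q) qp D).
Qed.

(** Composing with a chart and back changes nothing near the point. *)
Lemma chart_pullback k p (F : plane R -> R) : chart_dom k p ->
  differentiable F (chart_map k p) ->
  differentiable ((F \o chart_map k) \o chart_inv k) (chart_map k p) /\
  forall v, 'D_v ((F \o chart_map k) \o chart_inv k) (chart_map k p) =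
    'D_v F (chart_map k p).
Proof.
move=> kp dF; have N : \forall y \near chart_map k p,
    F y = ((F \o chart_map k) \o chart_inv k) y.
  apply: filterS (near_chart (@chart_dom_open _ _ k) kp kp) => _ [q [kq _] <-] /=.
  by rewrite chart_mapK.
split=> [|v]; last by apply/esym/near_eq_derive.
have [] := @differentiable_plane R ((F \o chart_map k) \o chart_inv k) (chart_map k p)
   ('D_dx F (chart_map k p)) ('D_dy F (chart_map k p)) => // e e0.
have := differentiable_plane_near dF e0.
apply: filterS2 N => y E; rewrite /= (chart_mapK kp) => H.
by move: E => /= <-.
Qed.

Lemma differential_pullback k p (F : plane R -> R) v : local_coordinates k ->
  chart_dom k p -> differentiable F (chart_map k p) ->
  differential (F \o chart_map k) p v =
    'D_dx F (chart_map k p) * differential (fst \o chart_map k) p v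
  + 'D_dy F (chart_map k p) * differential (snd \o chart_map k) p v.
Proof.
move=> lk kp dF; have [d E] := chart_pullback kp dF.
by rewrite -!E; exact: differential_chart.
Qed.

(** Writing [f] in the coordinates (u, v), the terms of [X (Y f) - Y (X f)] with
    second derivatives of [f] cancel by symmetry; the others are the components
    of the bracket paired with the partial derivatives of [f]. *)
Lemma act_bracket A X Y f p : open A -> A p -> smooth_field X -> smooth_field Y ->
  smooth_on A f -> act (bracket X Y) f p = act X (act Y f) p - act Y (act X f) p.
Proof.
move=> oA Ap sX sY sf; set k := chart_at p.
have kp : chart_dom k p by exact: mem_chart_at.
have lk : local_coordinates k by exact: local_coordinates_atlas.
have ok := @chart_dom_open _ _ k.
set U := chart_map k @` (chart_dom k `&` A).
have oU : open U by exact: chart_image_setI_open.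
have Up : U (chart_map k p) by exists p.
pose fx := 'D_dx (f \o chart_inv k) \o chart_map k.
pose fy := 'D_dy (f \o chart_inv k) \o chart_map k.
have sF := sf p : smooth U (f \o chart_inv k).
have dFx : differentiable ('D_dx (f \o chart_inv k)) (chart_map k p).
  exact: smooth_differentiable oU (smooth_dx sF) Up.
have dFy : differentiable ('D_dy (f \o chart_inv k)) (chart_map k p).
  exact: smooth_differentiable oU (smooth_dy sF) Up.
have actE Z q : chart_dom k q -> A q -> act Z f q =
    fx q * act Z (fst \o chart_map k) q + fy q * act Z (snd \o chart_map k) q.
  move=> kq Aq; apply: act_chart => //.
  by apply: smooth_differentiable oU sF _; exists q.
have actF Z (F : plane R -> R) : differentiable F (chart_map k p) ->
    act Z (F \o chart_map k) p = 'D_dx F (chart_map k p) * act Z (fst \o chart_map k) p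
       + 'D_dy F (chart_map k p) * act Z (snd \o chart_map k) p.
  by move=> dF; exact: differential_pullback.
have diffF (F : plane R -> R) : differentiable F (chart_map k p) ->
  diff_at (F \o chart_map k) p.
  by move=> dF; have [] := chart_pullback kp dF.
have [su sv] := smooth_on_coord lk.
have smu Z : smooth_field Z -> diff_at (act Z (fst \o chart_map k)) p.
  by move=> sZ; apply: (smooth_on_diff_at ok _ kp); exact: smooth_act.
have smv Z : smooth_field Z -> diff_at (act Z (snd \o chart_map k)) p.
  by move=> sZ; apply: (smooth_on_diff_at ok _ kp); exact: smooth_act.
have diffM h1 h2 : diff_at h1 p -> diff_at h2 p -> diff_at (fun q => h1 q * h2 q) p.
  by move=> d1 d2; exact: differentiableM.
have second Z1 Z2 : smooth_field Z1 -> smooth_field Z2 -> act Z1 (act Z2 f) p =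
   fx p * act Z1 (act Z2 (fst \o chart_map k)) p
   + act Z2 (fst \o chart_map k) p * act Z1 fx p
   + (fy p * act Z1 (act Z2 (snd \o chart_map k)) p
   + act Z2 (snd \o chart_map k) p * act Z1 fy p).
  move=> s1 s2.
  rewrite (@act_eq Z1 (chart_dom k `&` A) _ (fun q =>
    fx q * act Z2 (fst \o chart_map k) q
     + fy q * act Z2 (snd \o chart_map k) q)); first last.
  - by move=> q [kq Aq]; exact: actE.
  - by split.
  - exact: openI.
  have d1 := diffF _ dFx; have d2 := diffF _ dFy.
  have := smu _ s2; have := smv _ s2 => dv du.
  rewrite actD; [|exact: diffM d1 du|exact: diffM d2 dv].
  by rewrite (actM Z1 d1 du) (actM Z1 d2 dv).
have first Z : act Z f p =
    fx p * act Z (fst \o chart_map k) p + fy p * act Z (snd \o chart_map k) p.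
  exact: actE.
rewrite (second X Y sX sY) (second Y X sY sX) first.
have ax Z : act Z fx p = _ := actF Z _ dFx.
have ay Z : act Z fy p = _ := actF Z _ dFy.
rewrite !ax !ay (schwarz oU sF Up).
move: ('D_dx ('D_dx _) _) ('D_dx ('D_dy _) _) ('D_dy ('D_dy _) _) => a b d.
have [Bu Bv] := differential_coord_self p (bracket X Y p).
have -> : act (bracket X Y) (fst \o chart_map k) p = (bracket X Y p).1 by exact: Bu.
have -> : act (bracket X Y) (snd \o chart_map k) p = (bracket X Y p).2 by exact: Bv.
rewrite /bracket /= -/k.
move: (fx p) (fy p) (act X (act Y (fst \o chart_map k)) p)
  (act Y (act X (fst \o chart_map k)) p) (act X (act Y (snd \o chart_map k)) p)
  (act Y (act X (snd \o chart_map k)) p) => ? ? ? ? ? ?.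
ring.
Qed.

End SurfaceCalculus.

(** * Riemannian metrics in coordinates *)

Section MetricCalculus.
Variables (R : realType) (M : oriented_surface R) (g : riemannian_metric M).
Implicit Types (A B : set M) (f h : M -> R) (p q : M) (k l : chart R M).
Implicit Types (X Y V W : M -> plane R) (v w z : plane R).

Local Notation uu k := (fst \o chart_map k).
Local Notation vv k := (snd \o chart_map k).

Lemma derive_pair (F : plane R -> plane R) (x v : plane R) :
  differentiable (fst \o F) x -> differentiable (snd \o F) x ->
  'D_v F x = ('D_v (fst \o F) x, 'D_v (snd \o F) x).
Proof.
move=> d1 d2.
have E : F = (fun y => ((fst \o F) y, (snd \o F) y)).
  by apply/funext => y /=; rewrite -surjective_pairing.
have dF : differentiable F x by rewrite E; exact: differentiable_pair.
rewrite !deriveE// {1}E.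
by rewrite (diff_pair d1 d2).
Qed.

Lemma transition_differentiable k p : local_coordinates k -> chart_dom k p ->
  differentiable (fst \o transition k (chart_at p)) (chart_map k p) /\
  differentiable (snd \o transition k (chart_at p)) (chart_map k p).
Proof.
move=> lk kp; have [[s1 s2] _] := lk p.
have O : overlap k (chart_at p) (chart_map k p).
  by exists p => //; split=> //; exact: mem_chart_at.
have oO := @overlap_open _ _ k (chart_at p).
by split; [exact: smooth_differentiable oO s1 O|exact: smooth_differentiable oO s2 O].
Qed.

(** Chain rule for the composite of the two transitions between the chart [k] and
    the distinguished chart at [p]. *)
Lemma chart_vectorK k p v : local_coordinates k -> chart_dom k p ->
  v = differential (uu k) p v *: chart_vector k dx p
    + differential (vv k) p v *: chart_vector k dy p.
Proof.
move=> lk kp; have [d1 d2] := transition_differentiable lk kp.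
rewrite /chart_vector !(derive_pair _ d1 d2).
have [e1 e2] := differential_coord_self p v.
apply/plane_eq; split; rewrite /= /GRing.scale /=.
- rewrite -[LHS]e1 (differential_chart v lk kp d1) mulrC; congr (_ + _).
  exact: mulrC.
- rewrite -[LHS]e2 (differential_chart v lk kp d2) mulrC; congr (_ + _).
  exact: mulrC.
Qed.

Lemma innerDZl p (a b : R) v w z :
  g p (a *: v + b *: w) z = a * g p v z + b * g p w z.
Proof.
have g0 : g p 0 z = 0.
  have := inner_linear g p 1 0 0 z; rewrite scale1r addr0 mul1r.
  by move=> E; apply: (addrI (g p 0 z)); rewrite addr0 -E.
by rewrite inner_linear -[b *: w]addr0 inner_linear g0 addr0.
Qed.

Lemma innerZl p (a : R) v z : g p (a *: v) z = a * g p v z.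
Proof.
by rewrite -[a *: v]addr0 -(scale0r v) innerDZl mul0r addr0.
Qed.

Lemma innerDZr p (a b : R) v w z :
  g p z (a *: v + b *: w) = a * g p z v + b * g p z w.
Proof. by rewrite inner_sym innerDZl !(inner_sym _ p z). Qed.

Definition metric_coef k p v w := g p (chart_vector k v p) (chart_vector k w p).

Lemma inner_expand k p v w : local_coordinates k -> chart_dom k p ->
  g p v w =
    differential (uu k) p v * differential (uu k) p w * metric_coef k p dx dx
  + (differential (uu k) p v * differential (vv k) p w
     + differential (vv k) p v * differential (uu k) p w) * metric_coef k p dx dy
  + differential (vv k) p v * differential (vv k) p w * metric_coef k p dy dy.
Proof.
move=> lk kp.
rewrite {1}(chart_vectorK v lk kp) {1}(chart_vectorK w lk kp).
rewrite /metric_coef.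
move: (chart_vector k dx p) (chart_vector k dy p) => z1 z2.
rewrite innerDZl !innerDZr (inner_sym g p z2 z1).
move: (differential _ _ v) (differential _ _ v) (differential _ _ w) (differential _
  _ w).
move=> ? ? ? ?; ring.
Qed.

(** [g] is given through tangent spaces that jump with the distinguished chart;
    smoothness is visible only after expansion in a fixed chart. *)
Lemma smooth_inner V W : smooth_field V -> smooth_field W ->
  smooth_fun (fun p => g p (V p) (W p)).
Proof.
move=> sV sW; apply: smooth_fun_atlas => q; set k := chart_at q.
have ok : open (chart_dom k) by exact: chart_dom_open.
have lk : local_coordinates k by exact: local_coordinates_atlas.
have [Vu Vv] := sV q; have [Wu Wv] := sW q.
apply: (smooth_on_eq ok _ (smooth_on_add ok (smooth_on_add ok
  (smooth_on_mul ok (smooth_on_mul ok Vu Wu) (inner_smooth g q dx dx))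
  (smooth_on_mul ok (smooth_on_add ok (smooth_on_mul ok Vu Wv) (smooth_on_mul ok Vv Wu))
    (inner_smooth g q dx dy)))
  (smooth_on_mul ok (smooth_on_mul ok Vv Wv) (inner_smooth g q dy dy)))).
by move=> p kp; exact: esym (inner_expand (V p) (W p) lk kp).
Qed.

Lemma smooth_on_fun A f : smooth_fun f -> smooth_on A f.
Proof. exact: smooth_on_sub. Qed.

Lemma act_coord_comb q (a b : R) X Y p : chart_dom (chart_at q) p ->
  differential (uu (chart_at q)) p (a *: X p + b *: Y p) =
    a * act X (uu (chart_at q)) p + b * act Y (uu (chart_at q)) p /\
  differential (vv (chart_at q)) p (a *: X p + b *: Y p) =
    a * act X (vv (chart_at q)) p + b * act Y (vv (chart_at q)) p.
Proof.
move=> kp.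
have [su sv] := smooth_on_coord (@local_coordinates_atlas _ M q).
have ok := @chart_dom_open _ _ (chart_at q).
by split; apply: differential_linear; [exact: smooth_on_diff_at ok su kp|
  exact: smooth_on_diff_at ok sv kp].
Qed.

Lemma smooth_field_comb (a b : M -> R) X Y : smooth_fun a -> smooth_fun b ->
  smooth_field X -> smooth_field Y ->
  smooth_field (fun p => a p *: X p + b p *: Y p).
Proof.
move=> sa sb sX sY q.
have ok : open (chart_dom (chart_at q)) by exact: chart_dom_open.
have [Xu Xv] := sX q; have [Yu Yv] := sY q.
have [ha hb] := (smooth_on_fun (chart_dom (chart_at q)) sa,
                 smooth_on_fun (chart_dom (chart_at q)) sb).
split.
- apply: (smooth_on_eq ok _ (smooth_on_add ok (smooth_on_mul ok ha Xu)
    (smooth_on_mul ok hb Yu))) => p kp.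
  by have [<- _] := act_coord_comb (a p) (b p) X Y kp.
- apply: (smooth_on_eq ok _ (smooth_on_add ok (smooth_on_mul ok ha Xv)
    (smooth_on_mul ok hb Yv))) => p kp.
  by have [_ <-] := act_coord_comb (a p) (b p) X Y kp.
Qed.

(** The determinant is multiplied by the Jacobian of a transition of the oriented
    atlas. *)
Lemma det2_components q p v w : chart_dom (chart_at q) p -> 0 < det2 v w ->
  0 < det2 (differential (uu (chart_at q)) p v, differential (vv (chart_at q)) p v)
           (differential (uu (chart_at q)) p w, differential (vv (chart_at q)) p w).
Proof.
move=> kp vw; set l := chart_at p; set k := chart_at q.
have pp := mem_chart_at p.
have O : overlap l k (chart_map l p) by exists p => //.
have oO := @overlap_open _ _ l k.
have [s1 s2] := atlas_smooth p q.
have d1 := smooth_differentiable oO s1 O; have d2 := smooth_differentiable oO s2 O.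
have := atlas_oriented O.
rewrite /Defs.jacobian !(derive_pair _ d1 d2) => J0.
have E1 z : differential (uu k) p z = z.1 * 'D_dx (fst \o transition l k) (chart_map
  l p)
   + z.2 * 'D_dy (fst \o transition l k) (chart_map l p).
  by rewrite -(derive_partials z d1).
have E2 z : differential (vv k) p z = z.1 * 'D_dx (snd \o transition l k) (chart_map
  l p)
   + z.2 * 'D_dy (snd \o transition l k) (chart_map l p).
  by rewrite -(derive_partials z d2).
rewrite !E1 !E2.
move: J0; rewrite /det2 /=.
move: ('D_dx _ _) ('D_dy _ _) ('D_dx _ _) ('D_dy _ _) => a b c d J0.
have := mulr_gt0 J0 vw; rewrite /det2.
set L := (X in 0 < X -> _); set L' := (X in _ -> 0 < X).
suff -> : L = L' by [].
by rewrite /L /L'; ring.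
Qed.

(** The first vector of an oriented orthonormal frame is the second one rotated
    by a right angle, so it depends smoothly on it: in coordinates the rotation
    has entries [g_ij / sqrt (det g)], and the square root is
    [exp (ln (det g) / 2)]. *)
Lemma smooth_rotation X Y : smooth_field Y ->
  (forall p, oriented_orthonormal g p (X p) (Y p)) -> smooth_field X.
Proof.
move=> sY fr q; set k := chart_at q.
have ok : open (chart_dom k) by exact: chart_dom_open.
have lk : local_coordinates k by exact: local_coordinates_atlas.
have [Yu Yv] := sY q.
pose E p := metric_coef k p dx dx; pose F p := metric_coef k p dx dy.
pose G p := metric_coef k p dy dy.
have sE : smooth_on (chart_dom k) E := inner_smooth g q dx dx.
have sF : smooth_on (chart_dom k) F := inner_smooth g q dx dy.
have sG : smooth_on (chart_dom k) G := inner_smooth g q dy dy.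
pose D p := E p * G p - F p * F p.
have sD : smooth_on (chart_dom k) D.
  exact: smooth_on_sub_fun ok (smooth_on_mul ok sE sG) (smooth_on_mul ok sF sF).
have key p : chart_dom k p -> 0 < D p /\
   (act X (uu k) p = expR (- 2^-1 * ln (D p)) * (F p * act Y (uu k) p + G p * act Y
     (vv k) p)
   /\ act X (vv k) p = - (expR (- 2^-1 * ln (D p)) * (E p * act Y (uu k) p + F p *
     act Y (vv k) p))).
  move=> kp; have [xx yy xy det0] := fr p.
  have := det2_components kp det0.
  move: xx yy xy; rewrite !(inner_expand _ _ lk kp) -/(E p) -/(F p) -/(G p).
  rewrite -!/(act X _ p) -!/(act Y _ p) /det2 /= -/k /D.
  move: (act X (uu k) p) (act X (vv k) p) (act Y (uu k) p) (act Y (vv k) p).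
  move: (E p) (F p) (G p) => e f gg a b c d xx yy xy.
  set lam := a * d - b * c => lam0.
  have L2 : (e * gg - f * f) * lam ^+ 2 = 1.
    rewrite /lam.
    have -> : (e * gg - f * f) * (a * d - b * c) ^+ 2 =
      (a * a * e + (a * b + b * a) * f + b * b * gg) *
      (c * c * e + (c * d + d * c) * f + d * d * gg) -
      (a * c * e + (a * d + b * c) * f + b * d * gg) ^+ 2 by ring.
    by rewrite xx yy xy; ring.
  have l2 : 0 < lam ^+ 2 by rewrite exprn_gt0.
  have D0 : 0 < e * gg - f * f.
    by rewrite -(pmulr_lgt0 _ l2) L2.
  split=> //.
  have -> : expR (- 2^-1 * ln (e * gg - f * f)) = lam.
    have -> : e * gg - f * f = (lam ^+ 2)^-1.
      by apply: (mulIf (lt0r_neq0 l2)); rewrite L2 mulVf// lt0r_neq0.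
    rewrite lnV ?posrE// lnXn//.
    have -> : - 2^-1 * - (ln lam *+ 2) = ln lam by rewrite mulr2n; field.
    by rewrite lnK ?posrE.
  rewrite /lam; split.
  - rewrite -[LHS]mulr1 -yy.
    have -> : a * (c * c * e + (c * d + d * c) * f + d * d * gg) =
      c * (a * c * e + (a * d + b * c) * f + b * d * gg) + (a * d - b * c) * (f * c +
        gg * d) by ring.
    by rewrite xy mulr0 add0r.
  - rewrite -[LHS]mulr1 -yy.
    have -> : b * (c * c * e + (c * d + d * c) * f + d * d * gg) =
      d * (a * c * e + (a * d + b * c) * f + b * d * gg) - (a * d - b * c) * (e * c +
        f * d) by ring.
    by rewrite xy mulr0 add0r.
have slam : smooth_on (chart_dom k) (fun p => expR (- 2^-1 * ln (D p))).
  apply: smooth_on_expR => //; apply: (smooth_on_mul ok (smooth_on_cst _ ok)).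
  by apply: smooth_on_ln => // p /key[].
split.
- apply: (smooth_on_eq ok _ (smooth_on_mul ok slam (smooth_on_add ok
    (smooth_on_mul ok sF Yu) (smooth_on_mul ok sG Yv)))).
  by move=> p /key[_ [-> _]].
- apply: (smooth_on_eq ok _ (smooth_on_opp ok (smooth_on_mul ok slam (smooth_on_add ok
    (smooth_on_mul ok sE Yu) (smooth_on_mul ok sF Yv))))).
  by move=> p /key[_ [_ ->]].
Qed.

End MetricCalculus.

(** * Orthonormal frames *)

Section OrthonormalFrame.
Variables (R : realType) (M : oriented_surface R) (g : riemannian_metric M).
Variable nabla : (M -> plane R) -> (M -> plane R) -> (M -> plane R).
Hypothesis nabla_lc : levi_civita g nabla.
Variables X1 X2 : M -> plane R.
Hypotheses (sX1 : smooth_field X1) (sX2 : smooth_field X2).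
Hypothesis frame : forall p, oriented_orthonormal g p (X1 p) (X2 p).

Lemma frame_decomp p (v : plane R) : v = g p v (X1 p) *: X1 p + g p v (X2 p) *: X2 p.
Proof.
have [xx yy xy det0] := frame p.
have [a [b E]] : exists a b, v = a *: X1 p + b *: X2 p.
  exists (det2 v (X2 p) / det2 (X1 p) (X2 p)), (det2 (X1 p) v / det2 (X1 p) (X2 p)).
  have := lt0r_neq0 det0; rewrite /det2 => d0.
  by apply/plane_eq; split; rewrite /= /GRing.scale /=; field.
have -> : g p v (X1 p) = a.
  by rewrite E innerDZl xx inner_sym xy mulr1 mulr0 addr0.
have -> : g p v (X2 p) = b.
  by rewrite E innerDZl yy xy mulr1 mulr0 add0r.
exact: E.
Qed.

(** The geodesic curvatures of the integral curves of [X1] and [X2], with respect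
    to the normals [X2] and [X1]. They determine the connection. *)
Definition geod1 p := g p (nabla X1 X1 p) (X2 p).
Definition geod2 p := g p (nabla X2 X2 p) (X1 p).

Let smooth_nabla X Y : smooth_field X -> smooth_field Y -> smooth_field (nabla X Y).
Proof. by case: nabla_lc => -[H _ _ _] _ _; exact: H. Qed.

Lemma smooth_geod1 : smooth_fun geod1.
Proof. exact: (smooth_inner g (smooth_nabla sX1 sX1) sX2). Qed.

Lemma smooth_geod2 : smooth_fun geod2.
Proof. exact: (smooth_inner g (smooth_nabla sX2 sX2) sX1). Qed.

Lemma metric_compat_cst X Y Z (c : R) : smooth_field X -> smooth_field Y ->
  smooth_field Z -> (forall p, g p (Y p) (Z p) = c) ->
  forall p, g p (nabla X Y p) (Z p) = - g p (Y p) (nabla X Z p).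
Proof.
move=> sX sY sZ H p; case: nabla_lc => _ _ /(_ X Y Z sX sY sZ p).
have -> : (fun q => g q (Y q) (Z q)) = fun=> c by exact/funext.
by rewrite act_cst => /esym/eqP; rewrite addr_eq0 => /eqP.
Qed.

Lemma metric_compat_unit X Y (c : R) : smooth_field X -> smooth_field Y ->
  (forall p, g p (Y p) (Y p) = c) -> forall p, g p (nabla X Y p) (Y p) = 0.
Proof.
move=> sX sY H p; have := metric_compat_cst sX sY sY H p.
by rewrite (inner_sym g p (Y p)); lra.
Qed.

Let X11 p : g p (X1 p) (X1 p) = 1. Proof. by have [] := frame p. Qed.
Let X22 p : g p (X2 p) (X2 p) = 1. Proof. by have [] := frame p. Qed.
Let X12 p : g p (X1 p) (X2 p) = 0. Proof. by have [] := frame p. Qed.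

Lemma nabla11 p : nabla X1 X1 p = geod1 p *: X2 p.
Proof.
by rewrite {1}(frame_decomp p (nabla X1 X1 p)) (metric_compat_unit sX1 sX1 X11)
  scale0r add0r.
Qed.

Lemma nabla22 p : nabla X2 X2 p = geod2 p *: X1 p.
Proof.
by rewrite {1}(frame_decomp p (nabla X2 X2 p)) (metric_compat_unit sX2 sX2 X22)
  scale0r addr0.
Qed.

Lemma nabla12 p : nabla X1 X2 p = - geod1 p *: X1 p.
Proof.
rewrite {1}(frame_decomp p (nabla X1 X2 p)) (metric_compat_unit sX1 sX2 X22) scale0r
  addr0.
by rewrite /geod1 (metric_compat_cst sX1 sX1 sX2 X12) opprK inner_sym.
Qed.

Lemma nabla21 p : nabla X2 X1 p = - geod2 p *: X2 p.
Proof.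
rewrite {1}(frame_decomp p (nabla X2 X1 p)) (metric_compat_unit sX2 sX1 X11) scale0r
  add0r.
by rewrite (metric_compat_cst sX2 sX1 sX2 X12) inner_sym.
Qed.

(** The connection is torsion free. *)
Lemma frame_bracket p : bracket X1 X2 p = - geod1 p *: X1 p + geod2 p *: X2 p.
Proof.
case: nabla_lc => _ /(_ X1 X2 sX1 sX2 p) <- _.
by rewrite nabla12 nabla21 scaleNr [in X in _ - X]scaleNr opprK.
Qed.

Lemma smooth_frame_bracket : smooth_field (bracket X1 X2).
Proof.
have -> : bracket X1 X2 = fun p => - geod1 p *: X1 p + geod2 p *: X2 p.
  by apply/funext => p; exact: frame_bracket.
apply: smooth_field_comb => //; last exact: smooth_geod2.
exact: smooth_on_opp openT smooth_geod1.
Qed.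

Section GaussianCurvature.
Variable K : M -> R.
Hypothesis K_gauss : gaussian_curvature g nabla K.

Lemma gaussian_curvature_frame p : K p = g p (curvature nabla X1 X2 X2 p) (X1 p).
Proof.
have [xx yy xy det0] := frame p.
rewrite (K_gauss sX1 sX2 (lt0r_neq0 det0)) xx yy xy.
by rewrite expr0n /= subr0 mul1r invr1 mulr1.
Qed.

(** The frame is global, so [K] is given everywhere by one formula in smooth
    fields. *)
Lemma smooth_gaussian_curvature : smooth_fun K.
Proof.
have sub3 p (a b d z : plane R) : g p (a - b - d) z = g p a z - g p b z - g p d z.
  have -> : a - b - d = 1 *: a + (-1) *: (1 *: b + 1 *: d).
    by rewrite !scale1r scaleN1r opprD addrA.
  by rewrite !innerDZl; ring.
have s1 := smooth_inner g (smooth_nabla sX1 (smooth_nabla sX2 sX2)) sX1.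
have s2 := smooth_inner g (smooth_nabla sX2 (smooth_nabla sX1 sX2)) sX1.
have s3 := smooth_inner g (smooth_nabla smooth_frame_bracket sX2) sX1.
apply: (smooth_on_eq openT _ (smooth_on_sub_fun openT (smooth_on_sub_fun openT s1 s2)
  s3)).
by move=> p _; rewrite gaussian_curvature_frame /curvature sub3.
Qed.

(** The structure equation for the curvature when the integral curves of [X1] are
    geodesics. *)
Lemma curvature_geodesic : (forall p, geod1 p = 0) ->
  forall p, K p = act X1 geod2 p - geod2 p ^+ 2.
Proof.
move=> a0 p; case: nabla_lc => -[_ lin1 _ leib] _ _.
have sc (c : R) : smooth_fun (fun _ : M => c) by exact: smooth_on_cst openT.
rewrite gaussian_curvature_frame /curvature.
have -> : nabla X2 X2 = fun q => geod2 q *: X1 q by apply/funext => q; exact: nabla22.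
have -> : nabla X1 X2 = fun q => 0 *: X1 q.
  by apply/funext => q; rewrite nabla12 a0 oppr0.
have -> : bracket X1 X2 = fun q => 0 *: X1 q + geod2 q *: X2 q.
  by apply/funext => q; rewrite frame_bracket a0 oppr0.
rewrite (leib _ _ _ smooth_geod2 sX1 sX1) (leib _ _ _ (sc 0) sX2 sX1).
rewrite (lin1 _ _ _ _ _ (sc 0) smooth_geod2 sX1 sX2 sX2).
rewrite nabla11 nabla22 a0 act_cst !scale0r scaler0 add0r addr0 subr0 add0r.
have -> : act X1 geod2 p *: X1 p - geod2 p *: (geod2 p *: X1 p) =
   act X1 geod2 p *: X1 p + (- geod2 p ^+ 2) *: X1 p.
  by rewrite scalerA expr2 scaleNr.
by rewrite innerDZl X11; ring.
Qed.

Hypothesis grad_neq0 : forall p : M, grad g K p != 0.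
Hypothesis X1_def : forall p : M,
  X1 p = (metric_norm g p (grad g K p))^-1 *: grad g K p.

(** [grad] is defined by choice, with default value 0; being nonzero, it does
    represent the differential. *)
Lemma differential_grad p v :
  differential K p v = metric_norm g p (grad g K p) * g p (X1 p) v /\
  0 < metric_norm g p (grad g K p).
Proof.
have G v' : g p (grad g K p) v' = differential K p v'.
  move: (grad_neq0 p); rewrite /grad; case: xgetP => [w -> //|_].
  by rewrite eqxx.
have n0 : 0 < metric_norm g p (grad g K p).
  by rewrite /metric_norm sqrtr_gt0 inner_pos.
split=> //; rewrite -G X1_def.
have -> : (metric_norm g p (grad g K p))^-1 *: grad g K p =
  (metric_norm g p (grad g K p))^-1 *: grad g K p + 0 *: grad g K p.
  by rewrite scale0r addr0.
by rewrite innerDZl mul0r addr0 mulrA divff ?mul1r// gt_eqF.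
Qed.

Lemma act1_K p : act X1 K p = metric_norm g p (grad g K p).
Proof. by rewrite /act (differential_grad p (X1 p)).1 X11 mulr1. Qed.

Lemma act1_K_gt0 p : 0 < act X1 K p.
Proof. by rewrite act1_K (differential_grad p 0).2. Qed.

Lemma act2_K p : act X2 K p = 0.
Proof. by rewrite /act (differential_grad p (X2 p)).1 X12 mulr0. Qed.

(** Apply [[X1, X2]] to [K] and use [X2 K = 0]. Hence [X2 X1 K = 0] if and only if
    the integral curves of the gradient are geodesics. *)
Lemma act21_K p : act X2 (act X1 K) p = geod1 p * act X1 K p.
Proof.
have sK := smooth_gaussian_curvature.
have := act_bracket openT I sX1 sX2 sK (p := p).
have -> : act X2 K = fun=> 0 by apply/funext => q; exact: act2_K.
rewrite act_cst sub0r {1}/act frame_bracket.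
rewrite (differential_linear _ _ _ _ (smooth_on_diff_at openT sK I)).
rewrite -/(act X1 K p) -/(act X2 K p) act2_K mulr0 addr0 mulNr.
by move=> /oppr_inj.
Qed.

End GaussianCurvature.
End OrthonormalFrame.

(** * The frame in isothermal coordinates *)

Section IsothermalToFrame.
Variables (R : realType) (M : oriented_surface R) (g : riemannian_metric M).
Variable nabla : (M -> plane R) -> (M -> plane R) -> (M -> plane R).
Hypothesis nabla_lc : levi_civita g nabla.
Variables X1 X2 : M -> plane R.
Hypotheses (sX1 : smooth_field X1) (sX2 : smooth_field X2).
Hypothesis frame : forall p, oriented_orthonormal g p (X1 p) (X2 p).
Variable K : M -> R.
Hypothesis X2K : forall p, act X2 K p = 0.

(** The coordinates are orthogonal and [K] is a function of [u], so [X1] and [X2]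
    are tangent to the coordinate lines and [X1 u], [X2 v] are both [exp (- phi u)]
    up to sign. The geodesic curvatures are read off by applying [[X1, X2]] to [u]
    and to [v]. *)
Lemma isothermal_frame (x : chart R M) (phi phi' k k' : R -> R) :
  local_coordinates x ->
  (forall q, chart_dom x q -> forall a b : plane R,
     g q a b = expR (2 * phi ((fst \o chart_map x) q)) *
       (differential (fst \o chart_map x) q a * differential (fst \o chart_map x) q b
      + differential (snd \o chart_map x) q a * differential (snd \o chart_map x) q
        b)) ->
  (forall q, chart_dom x q -> K q = k ((fst \o chart_map x) q)) ->
  (forall q, chart_dom x q ->
     [/\ is_derive ((fst \o chart_map x) q) 1 phi (phi' ((fst \o chart_map x) q)),
         is_derive ((fst \o chart_map x) q) 1 k (k' ((fst \o chart_map x) q)) &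
         k' ((fst \o chart_map x) q) != 0]) ->
  forall q, chart_dom x q ->
    [/\ geod1 g nabla X1 X2 q = 0,
        act X1 K q = k' ((fst \o chart_map x) q) * act X1 (fst \o chart_map x) q &
        geod2 g nabla X1 X2 q
          = - phi' ((fst \o chart_map x) q) * act X1 (fst \o chart_map x) q].
Proof.
move=> lx; set u := fst \o chart_map x; set v := snd \o chart_map x.
move=> gE KE dE.
have ox : open (chart_dom x) by exact: chart_dom_open.
have [su sv] : smooth_on (chart_dom x) u /\ smooth_on (chart_dom x) v.
  exact: smooth_on_coord.
have ZK Z q : chart_dom x q -> act Z K q = k' (u q) * act Z u q.
  move=> xq; rewrite (@act_eq _ _ Z _ K (k \o u) q ox xq)//.
  by apply: act_comp; [exact: smooth_on_diff_at ox su xq|have [] := dE q xq].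
have X2u q : chart_dom x q -> act X2 u q = 0.
  move=> xq; have := ZK X2 q xq; rewrite X2K => /esym/eqP; rewrite mulf_eq0.
  by have [_ _ /negbTE ->] := dE q xq => /eqP.
have metric q : chart_dom x q -> [/\ act X1 v q = 0, act X2 v q != 0, act X1 u q != 0,
    act X1 u q * act X1 u q = expR (- 2 * phi (u q)) &
    act X2 v q * act X2 v q = expR (- 2 * phi (u q))].
  move=> xq; have [] := frame q; rewrite !gE//.
  rewrite -!/(act X1 _ q) -!/(act X2 _ q) X2u// !(mulr0, mul0r, add0r) =>
    e11 e22 /eqP e12 _.
  have ep : 0 < expR (2 * phi (u q)) by exact: expR_gt0.
  have v2 : act X2 v q != 0.
    by apply: contra_eq_neq e22 => ->; rewrite !mulr0 eq_sym oner_neq0.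
  have v1 : act X1 v q = 0.
    move: e12; rewrite !mulf_eq0 (negbTE v2) orbF (gt_eqF ep) /=.
    by move/eqP.
  move: e11; rewrite v1 mulr0 addr0 => e11.
  have u1 : act X1 u q != 0.
    by apply: contra_eq_neq e11 => ->; rewrite !mulr0 eq_sym oner_neq0.
  have -> : expR (- 2 * phi (u q)) = (expR (2 * phi (u q)))^-1.
    by rewrite mulNr expRN.
  by split=> //; apply: (mulfI (lt0r_neq0 ep)); rewrite ?e11 ?e22 divff// gt_eqF.
(* Squares avoid a discussion of the signs of [X1 u] and [X2 v]. *)
have square Z w q : chart_dom x q -> smooth_on (chart_dom x) w ->
    (forall q', chart_dom x q' -> w q' * w q' = expR (- 2 * phi (u q'))) ->
    w q * act Z w q = - phi' (u q) * act Z u q * (w q * w q).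
  move=> xq sw wE.
  have dw := smooth_on_diff_at ox sw xq.
  have := actM Z dw dw.
  rewrite (@act_eq _ _ Z _ _ _ q ox xq wE).
  have [dphi _ _] := dE q xq.
  have dexp : is_derive (u q) 1 (fun t => expR (- 2 * phi t))
      (expR (- 2 * phi (u q)) * (- 2 * phi' (u q))).
    by apply: (@is_derive1_comp _ expR (fun t => - 2 * phi t)).
  rewrite (act_comp Z (smooth_on_diff_at ox su xq) dexp) wE//.
  move=> E; apply: (@mulfI _ 2); first by rewrite pnatr_eq0.
  have -> : 2 * (w q * act Z w q) = w q * act Z w q + w q * act Z w q by ring.
  by rewrite -E; ring.
move=> q xq.
have [X1v X2v X1u u2 v2] := metric q xq.
have s1u := smooth_act ox sX1 su; have s2u := smooth_act ox sX2 su.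
have s1v := smooth_act ox sX1 sv; have s2v := smooth_act ox sX2 sv.
have X2X1u : act X2 (act X1 u) q = 0.
  have := square X2 (act X1 u) q xq s1u _.
  rewrite X2u// mulr0 mul0r => /(_ _)/eqP; rewrite mulf_eq0 (negbTE X1u) /=.
  by move=> H; apply/eqP/H => q' /metric[].
have X1X2v : act X1 (act X2 v) q = - phi' (u q) * act X1 u q * act X2 v q.
  apply: (mulfI X2v); rewrite (square X1 (act X2 v) q xq s2v); first by ring.
  by move=> q' /metric[].
have X1X2u : act X1 (act X2 u) q = 0.
  by rewrite (@act_eq _ _ X1 _ _ (fun=> 0) q ox xq) ?act_cst.
have X2X1v : act X2 (act X1 v) q = 0.
  rewrite (@act_eq _ _ X2 _ _ (fun=> 0) q ox xq) ?act_cst//.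
  by move=> q' /metric[].
have Bu := act_bracket ox xq sX1 sX2 su.
have Bv := act_bracket ox xq sX1 sX2 sv.
have du := smooth_on_diff_at ox su xq; have dv := smooth_on_diff_at ox sv xq.
move: Bu Bv; rewrite X2X1u X1X2v X1X2u X2X1v !subr0.
rewrite {1}/act (frame_bracket nabla_lc sX1 sX2 frame) (differential_linear _ _ _ _ du).
rewrite -/(act X1 u q) -/(act X2 u q) X2u// mulr0 addr0 mulNr.
move=> /eqP; rewrite oppr_eq0 mulf_eq0 (negbTE X1u) orbF => /eqP a0.
rewrite {1}/act (frame_bracket nabla_lc sX1 sX2 frame) (differential_linear _ _ _ _ dv).
rewrite -/(act X1 v q) -/(act X2 v q) X1v mulr0 add0r => /(mulIf X2v) b0.
by split; [exact: a0|exact: ZK|exact: b0].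
Qed.

End IsothermalToFrame.

(** * Isothermal coordinates from the frame *)

Section Forms.
Variables (R : realType) (M : oriented_surface R).
Implicit Types (k : chart R M) (P Q : plane R -> R) (X Y : M -> plane R).

(** The formula [(d w)(X, Y) = X (w Y) - Y (w X) - w [X, Y]] for the 1-form
    [w = P du + Q dv]. It reduces closedness to the brackets of a frame. *)
Lemma exterior_derivative k P Q X Y p (U := chart_map k @` chart_dom k)
  (w := fun (Z : M -> plane R) q =>
     P (chart_map k q) * act Z (fst \o chart_map k) q
   + Q (chart_map k q) * act Z (snd \o chart_map k) q) :
  local_coordinates k -> chart_dom k p -> smooth U P -> smooth U Q ->
  smooth_field X -> smooth_field Y ->
  ('D_dx Q (chart_map k p) - 'D_dy P (chart_map k p)) *
    (act X (fst \o chart_map k) p * act Y (snd \o chart_map k) p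
     - act Y (fst \o chart_map k) p * act X (snd \o chart_map k) p) =
  act X (w Y) p - act Y (w X) p - w (bracket X Y) p.
Proof.
move=> lk kp sP sQ sX sY.
have ok : open (chart_dom k) by exact: chart_dom_open.
have oU : open U by exact: chart_image_open.
have Up : U (chart_map k p) by exists p.
have dP := smooth_differentiable oU sP Up.
have dQ := smooth_differentiable oU sQ Up.
have [su sv] := smooth_on_coord lk.
have atlas_k F : smooth U F -> smooth_on (chart_dom k) (F \o chart_map k).
  move=> sF q.
  have oB := @chart_image_setI_open _ _ (chart_at q) _ ok.
  have S := @smooth_comp _ _ U F (fst \o chart_map k \o chart_inv (chart_at q))
    (snd \o chart_map k \o chart_inv (chart_at q)) oB oU (su q) (sv q) _ sF.
  apply: (smooth_eq oB _ (S _)) => [y _|_ [p' [qp' kp'] <-]] /=;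
    rewrite -surjective_pairing//.
  by rewrite (chart_mapK qp'); exists p'.
have dp := smooth_on_diff_at ok (atlas_k P sP) kp.
have dq := smooth_on_diff_at ok (atlas_k Q sQ) kp.
have smu Z : smooth_field Z -> diff_at (act Z (fst \o chart_map k)) p.
  by move=> sZ; exact: smooth_on_diff_at ok (smooth_act ok sZ su) kp.
have smv Z : smooth_field Z -> diff_at (act Z (snd \o chart_map k)) p.
  by move=> sZ; exact: smooth_on_diff_at ok (smooth_act ok sZ sv) kp.
have diffM (h1 h2 : M -> R) : diff_at h1 p -> diff_at h2 p -> diff_at (fun q =>
  h1 q * h2 q) p.
  by move=> d1 d2; exact: differentiableM.
have first Z1 Z2 : smooth_field Z1 -> smooth_field Z2 -> act Z1 (w Z2) p =
    P (chart_map k p) * act Z1 (act Z2 (fst \o chart_map k)) p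
  + act Z2 (fst \o chart_map k) p * act Z1 (P \o chart_map k) p
  + (Q (chart_map k p) * act Z1 (act Z2 (snd \o chart_map k)) p
  + act Z2 (snd \o chart_map k) p * act Z1 (Q \o chart_map k) p).
  move=> s1 s2; have du := smu _ s2; have dv := smv _ s2.
  rewrite (actD Z1 (diffM _ _ dp du) (diffM _ _ dq dv)).
  by rewrite (actM Z1 dp du) (actM Z1 dq dv).
have aP Z : act Z (P \o chart_map k) p = _ := differential_pullback (Z p) lk kp dP.
have aQ Z : act Z (Q \o chart_map k) p = _ := differential_pullback (Z p) lk kp dQ.
rewrite (first X Y sX sY) (first Y X sY sX) !aP !aQ /w.
rewrite (act_bracket ok kp sX sY su) (act_bracket ok kp sX sY sv).
rewrite -!/(act X _ p) -!/(act Y _ p).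
move: ('D_dx P _) ('D_dy P _) ('D_dx Q _) ('D_dy Q _) => a b d e.
move: (act X (act Y (fst \o chart_map k)) p) (act X (act Y (snd \o chart_map k)) p)
  (act Y (act X (fst \o chart_map k)) p) (act Y (act X (snd \o chart_map k)) p) =>
    ? ? ? ?.
ring.
Qed.

(** The transitions of the new chart are those of [k] composed with [F] or with its
    inverse [G], so both must be smooth. *)
Lemma change_coordinates k (F1 F2 : plane R -> R) (W : set (plane R))
    (G : plane R -> plane R) : local_coordinates k ->
  let F x := (F1 x, F2 x) in
  W `<=` chart_map k @` chart_dom k -> open W -> open (F @` W) ->
  smooth W F1 -> smooth W F2 -> (forall x, W x -> G (F x) = x) ->
  smooth (F @` W) (fst \o G) -> smooth (F @` W) (snd \o G) ->
  exists x : chart R M,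
  [/\ local_coordinates x,
      forall q, chart_dom x q <-> chart_dom k q /\ W (chart_map k q),
      chart_map x = F \o chart_map k & chart_map x @` chart_dom x = F @` W].
Proof.
move=> lk F WU oW oFW s1 s2 GF sG1 sG2.
have ok : open (chart_dom k) by exact: chart_dom_open.
set D : set M := chart_dom k `&` (chart_map k @^-1` W).
have oD : open D.
  rewrite openE => q [kq Wq]; apply: filterI; first exact: open_nbhs_nbhs.
  exact: (chart_map_continuous kq) (near_open oW Wq).
have imE : (F \o chart_map k) @` D = F @` W.
  apply/seteqP; split=> [_ [q [kq Wq] <-]|_ [y Wy <-]]; first by exists (chart_map k q).
  by have [q kq E] := WU y Wy; exists q; [split=> //; rewrite /= E|rewrite /= E].
have mK q : D q -> chart_inv k (G (F (chart_map k q))) = q.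
  by move=> [kq Wq]; rewrite GF// chart_mapK.
have cF y : W y -> F z @[z --> y] --> F y.
  by move=> Wy; exact: cvg_pair (smooth_continuous s1 Wy) (smooth_continuous s2 Wy).
have cM q : D q -> {for q, continuous (F \o chart_map k)}.
  move=> [kq Wq]; apply: continuous_comp; first exact: chart_map_continuous.
  exact: cF.
have cI z : ((F \o chart_map k) @` D) z -> {for z, continuous (chart_inv k \o G)}.
  rewrite imE => -[y Wy <-]; apply: continuous_comp.
    have VFy : (F @` W) (F y) by exists y.
    have -> : G = (fun z => ((fst \o G) z, (snd \o G) z)).
      by apply/funext => z' /=; rewrite -surjective_pairing.
    exact: cvg_pair (smooth_continuous sG1 VFy) (smooth_continuous sG2 VFy).
  by rewrite GF//; apply: chart_inv_continuous; exact: WU.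
have oI : open ((F \o chart_map k) @` D) by rewrite imE.
pose x := Chart oD oI mK cM cI.
exists x; split=> // q; split.
- have oO := @overlap_open _ _ x (chart_at q).
  have [[t1 t2] _] := lk q.
  have sub : overlap x (chart_at q) `<=` F @` W.
    by rewrite -imE => _ [p [Dp _] <-]; exists p.
  have B y : overlap x (chart_at q) y -> overlap k (chart_at q) (G y).
    move=> [p [[kp Wp] qp] <-] /=; rewrite GF//; exists p => //.
  have oK := @overlap_open _ _ k (chart_at q).
  have comp h : smooth (overlap k (chart_at q)) h ->
    smooth (overlap x (chart_at q)) (h \o G).
    move=> sh; have S := @smooth_comp _ _ _ h (fst \o G) (snd \o G) oO oK
      (smooth_sub sub sG1) (smooth_sub sub sG2) _ sh.
    apply: (smooth_eq oO _ (S _)) => [y _|y Oy] /=; rewrite -surjective_pairing//.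
    exact: B.
  by split; [exact: comp t1|exact: comp t2].
- have oO := @overlap_open _ _ (chart_at q) x.
  have [_ [t1 t2]] := lk q.
  have sub : overlap (chart_at q) x `<=` overlap (chart_at q) k.
    by move=> _ [p [qp [kp _]] <-]; exists p.
  have comp h : smooth W h ->
      smooth (overlap (chart_at q) x) (h \o transition (chart_at q) k).
    move=> sh; have S := @smooth_comp _ _ W h (fst \o transition (chart_at q) k)
      (snd \o transition (chart_at q) k) oO oW (smooth_sub sub t1) (smooth_sub sub
        t2) _ sh.
    apply: (smooth_eq oO _ (S _)) => [y _|_ [p [qp [kp Wp]] <-]] /=;
      rewrite -surjective_pairing//.
    by rewrite /transition /= chart_mapK.
  by split; [exact: comp s1|exact: comp s2].
Qed.

End Forms.

Section FrameToIsothermal.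
Variables (R : realType) (M : oriented_surface R) (g : riemannian_metric M).
Variable nabla : (M -> plane R) -> (M -> plane R) -> (M -> plane R).
Hypothesis nabla_lc : levi_civita g nabla.
Variables X1 X2 : M -> plane R.
Hypotheses (sX1 : smooth_field X1) (sX2 : smooth_field X2).
Hypothesis frame : forall p, oriented_orthonormal g p (X1 p) (X2 p).

(** Let [theta1, theta2] be the coframe dual to [X1, X2]. The conditions on [rho] are
    exactly that [rho * theta1] and [rho * theta2] be closed, given
    [[X1, X2] = geod2 X2]; their primitives are the coordinates. *)
Lemma isothermal_chart (rho : M -> R) : smooth_fun rho ->
  (forall p, 0 < rho p) -> (forall p, geod1 g nabla X1 X2 p = 0) ->
  (forall p, act X1 rho p = geod2 g nabla X1 X2 p * rho p) ->
  (forall p, act X2 rho p = 0) ->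
  forall p, exists (x : chart R M) (z : plane R) (s : R),
  [/\ local_coordinates x, chart_dom x p, 0 < s,
      chart_map x @` chart_dom x = ball z s &
      forall q, chart_dom x q ->
        [/\ act X1 (fst \o chart_map x) q = rho q, act X2 (fst \o chart_map x) q = 0,
            act X1 (snd \o chart_map x) q = 0 & act X2 (snd \o chart_map x) q = rho q]].
Proof.
move=> srho rho0 a0 X1rho X2rho p; set k := chart_at p.
have ok : open (chart_dom k) by exact: chart_dom_open.
have lk : local_coordinates k by exact: local_coordinates_atlas.
have kp : chart_dom k p by exact: mem_chart_at.
set U := chart_map k @` chart_dom k.
have oU : open U by exact: chart_image_open.
set u := fst \o chart_map k; set v := snd \o chart_map k.
have [su sv] : smooth_on (chart_dom k) u /\ smooth_on (chart_dom k) v.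
  exact: smooth_on_coord.
have s1u := smooth_act ok sX1 su; have s2u := smooth_act ok sX2 su.
have s1v := smooth_act ok sX1 sv; have s2v := smooth_act ok sX2 sv.
pose D q := act X1 u q * act X2 v q - act X2 u q * act X1 v q.
have sD : smooth_on (chart_dom k) D.
  exact: smooth_on_sub_fun ok (smooth_on_mul ok s1u s2v) (smooth_on_mul ok s2u s1v).
have D0 q : chart_dom k q -> D q != 0.
  move=> kq; have [_ _ _ d0] := frame q.
  have := det2_components kq d0; rewrite /det2 /= => /lt0r_neq0.
  by rewrite [X in _ - X]mulrC.
have srD : smooth_on (chart_dom k) (fun q => rho q / D q).
  exact: smooth_on_div ok (smooth_on_fun _ srho) sD D0.
have toplane f : smooth_on (chart_dom k) f -> smooth U (f \o chart_inv k).
  by move=> /(_ p); rewrite setIid.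
pose P1 := (fun q => rho q / D q * act X2 v q) \o chart_inv k.
pose Q1 := (fun q => - (rho q / D q * act X2 u q)) \o chart_inv k.
pose P2 := (fun q => - (rho q / D q * act X1 v q)) \o chart_inv k.
pose Q2 := (fun q => rho q / D q * act X1 u q) \o chart_inv k.
have sP1 : smooth U P1 by apply: toplane; exact: smooth_on_mul ok srD s2v.
have sQ1 : smooth U Q1 by apply: toplane;
  exact: smooth_on_opp ok (smooth_on_mul ok srD s2u).
have sP2 : smooth U P2 by apply: toplane;
  exact: smooth_on_opp ok (smooth_on_mul ok srD s1v).
have sQ2 : smooth U Q2 by apply: toplane; exact: smooth_on_mul ok srD s1u.
pose w (P Q : plane R -> R) (Z : M -> plane R) q :=
  P (chart_map k q) * act Z u q + Q (chart_map k q) * act Z v q.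
have w1X1 q : chart_dom k q -> w P1 Q1 X1 q = rho q.
  move=> kq; rewrite /w /P1 /Q1 /= chart_mapK//; have := D0 q kq; rewrite /D.
  move: (act X1 u q) (act X2 u q) (act X1 v q) (act X2 v q) => a b d e ?; field.
  done.
have w1X2 q : chart_dom k q -> w P1 Q1 X2 q = 0.
  by move=> kq; rewrite /w /P1 /Q1 /= chart_mapK//; ring.
have w2X1 q : chart_dom k q -> w P2 Q2 X1 q = 0.
  by move=> kq; rewrite /w /P2 /Q2 /= chart_mapK//; ring.
have w2X2 q : chart_dom k q -> w P2 Q2 X2 q = rho q.
  move=> kq; rewrite /w /P2 /Q2 /= chart_mapK//; have := D0 q kq; rewrite /D.
  move: (act X1 u q) (act X2 u q) (act X1 v q) (act X2 v q) => a b d e ?; field.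
  done.
have wbr P Q q : chart_dom k q -> w P Q (bracket X1 X2) q =
    geod2 g nabla X1 X2 q * w P Q X2 q.
  move=> kq; have br := frame_bracket nabla_lc sX1 sX2 frame q.
  have E f : diff_at f q ->
    act (bracket X1 X2) f q = geod2 g nabla X1 X2 q * act X2 f q.
    move=> df; rewrite {1}/act br a0 oppr0 (differential_linear _ _ _ _ df).
    by rewrite mul0r add0r.
  rewrite /w (E u (smooth_on_diff_at ok su kq)) (E v (smooth_on_diff_at ok sv kq)).
  ring.
(* [P1 du + Q1 dv = rho * theta1] and [P2 du + Q2 dv = rho * theta2] *)
have closed1 y : U y -> 'D_dy P1 y = 'D_dx Q1 y.
  move=> [q kq <-]; apply/eqP; rewrite eq_sym -subr_eq0.
  have := exterior_derivative lk kq sP1 sQ1 sX1 sX2.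
  rewrite -/(D q) -/(w P1 Q1 X1) -/(w P1 Q1 X2) -/(w P1 Q1 (bracket X1 X2) q).
  rewrite (@act_eq _ _ X1 _ (w P1 Q1 X2) (fun=> 0) q ok kq w1X2) act_cst.
  rewrite (@act_eq _ _ X2 _ (w P1 Q1 X1) rho q ok kq w1X1) X2rho.
  rewrite wbr// w1X2// mulr0 !subr0 => /eqP.
  by rewrite mulf_eq0 (negbTE (D0 q kq)) orbF.
have closed2 y : U y -> 'D_dy P2 y = 'D_dx Q2 y.
  move=> [q kq <-]; apply/eqP; rewrite eq_sym -subr_eq0.
  have := exterior_derivative lk kq sP2 sQ2 sX1 sX2.
  rewrite -/(D q) -/(w P2 Q2 X1) -/(w P2 Q2 X2) -/(w P2 Q2 (bracket X1 X2) q).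
  rewrite (@act_eq _ _ X1 _ (w P2 Q2 X2) rho q ok kq w2X2) X1rho.
  rewrite (@act_eq _ _ X2 _ (w P2 Q2 X1) (fun=> 0) q ok kq w2X1) act_cst.
  rewrite wbr// w2X2// subr0 subrr => /eqP.
  by rewrite mulf_eq0 (negbTE (D0 q kq)) orbF.
set y0 := chart_map k p.
have Uy0 : U y0 by exists p.
have /near_ballP[r r0 rU] := near_open oU Uy0.
have [f1 f1E] := poincare r0 (smooth_sub rU sP1) (smooth_sub rU sQ1)
  (fun y H => closed1 y (rU y H)).
have [f2 f2E] := poincare r0 (smooth_sub rU sP2) (smooth_sub rU sQ2)
  (fun y H => closed2 y (rU y H)).
set B := ball y0 (r / 2) in f1E f2E.
have BU : B `<=` U.
  move=> y /ball_normE_plane By; apply: rU; apply/ball_normE_plane.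
  by apply: lt_le_trans By _; lra.
have oB : open B by exact: open_square.
have sf1 := smooth_primitive oB (smooth_sub BU sP1) (smooth_sub BU sQ1) f1E.
have sf2 := smooth_primitive oB (smooth_sub BU sP2) (smooth_sub BU sQ2) f2E.
have r20 : 0 < r / 2 by lra.
have By0 : B y0 by exact: ballxx.
have J0 : pd_jacobian f1 f2 y0 != 0.
  rewrite /pd_jacobian; have [[_ ->] [_ ->]] := f1E y0 By0; have [[_ ->] [_ ->]] :=
    f2E y0 By0.
  rewrite /P1 /Q1 /P2 /Q2 /= chart_mapK//.
  have -> : rho p / D p * act X2 v p * (rho p / D p * act X1 u p) -
     - (rho p / D p * act X2 u p) * - (rho p / D p * act X1 v p) =
     (rho p / D p) ^+ 2 * D p by rewrite /D; ring.
  by rewrite mulf_neq0 ?D0// expf_neq0// mulf_neq0 ?invr_eq0 ?D0// gt_eqF.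
have [W [G [s [[oW Wy0 WB s0 FW] [GF sG]]]]] := inverse_function oB By0 sf1 sf2 J0.
have WU : W `<=` U by move=> y /WB/BU.
have oFW : open ((fun x => (f1 x, f2 x)) @` W) by rewrite FW; exact: open_square.
have [x [lx xD xM xI]] := change_coordinates lk WU oW oFW (smooth_sub WB sf1)
  (smooth_sub WB sf2) GF (sG _ (smooth_fst oW)) (sG _ (smooth_snd oW)).
exists x, (f1 y0, f2 y0), s; split=> //.
- by apply/xD.
- by rewrite xI FW.
move=> q /xD[kq Wq].
have Bq := WB _ Wq.
have uE Z : act Z (fst \o chart_map x) q = w P1 Q1 Z q.
  have -> : fst \o chart_map x = f1 \o chart_map k by rewrite xM.
  rewrite /act (differential_pullback _ lk kq (smooth_differentiable oB sf1 Bq)).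
  by have [[_ ->] [_ ->]] := f1E _ Bq.
have vE Z : act Z (snd \o chart_map x) q = w P2 Q2 Z q.
  have -> : snd \o chart_map x = f2 \o chart_map k by rewrite xM.
  rewrite /act (differential_pullback _ lk kq (smooth_differentiable oB sf2 Bq)).
  by have [[_ ->] [_ ->]] := f2E _ Bq.
by rewrite !uE !vE w1X1// w1X2// w2X1// w2X2.
Qed.

End FrameToIsothermal.

(** * The differential equation and the equivalence *)

Section WarpingFunction.
Variable R : realType.
Implicit Types (c t s a : R).

(** Multiplied by [exp (- 2 phi)], the differential equation says that
    [phi' = 3 k' / (8 (c - k))], where [k'] is given in terms of [phi]. *)
Lemma isothermal_ode c (kt phi p1 p2 p3 : R) :
  c - kt = c + expR (- 2 * phi) * p2 ->
  8 * c * expR (2 * phi) * p1 + 2 * p1 * p2 + 3 * p3 = 0 <->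
  8 * (c - kt) * p1 = 3 * (expR (- 2 * phi) * (2 * p1 * p2 - p3)).
Proof.
move=> ->.
have E1 : expR (- 2 * phi) * expR (2 * phi) = 1.
  by rewrite mulNr -expRD addNr expR0.
have E0 : expR (- 2 * phi) != 0 by rewrite gt_eqF ?expR_gt0.
set e := expR (- 2 * phi) in E1 E0 *; set e' := expR (2 * phi) in E1 *.
have -> : 8 * (c + e * p2) * p1 = 3 * (e * (2 * p1 * p2 - p3)) <->
    e * (8 * c * e' * p1 + 2 * p1 * p2 + 3 * p3) = 0.
  have -> : e * (8 * c * e' * p1 + 2 * p1 * p2 + 3 * p3) =
    (e * e') * (8 * c * p1) + e * (2 * p1 * p2 + 3 * p3) by ring.
  by rewrite E1; split=> H; lra.
split=> [->|/eqP]; first by rewrite mulr0.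
by rewrite mulf_eq0 (negbTE E0) => /eqP.
Qed.

Lemma is_derive_ln_sub c s : 0 < c - s ->
  is_derive s 1 (fun s => ln (c - s)) (- (c - s)^-1).
Proof.
move=> cs; have -> : - (c - s)^-1 = (c - s)^-1 * (0 - 1) by ring.
have dl := is_derive1_ln cs.
by apply: (@is_derive1_comp _ (@ln R) (fun s => c - s)).
Qed.

Lemma is_derive_expR_comp (f : R -> R) t d : is_derive t 1 f d ->
  is_derive t 1 (fun t => expR (f t)) (expR (f t) * d).
Proof. by move=> df; apply: (@is_derive1_comp _ expR f). Qed.

Lemma is_derive_scale (f : R -> R) a t d : is_derive t 1 f d ->
  is_derive t 1 (fun t => a * f t) (a * d).
Proof. by move=> df; have := is_deriveZ a df; exact. Qed.

Lemma is_derive_mul (f h : R -> R) t d e : is_derive t 1 f d -> is_derive t 1 h e ->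
  is_derive t 1 (fun t => f t * h t) (f t * e + h t * d).
Proof. by move=> df dh; have := is_deriveM df dh; exact. Qed.

Lemma smooth1_is_derive (I : set R) (f : R -> R) n t : smooth1 I f -> I t ->
  is_derive t 1 (f^`(n)%classic) (f^`(n.+1)%classic t).
Proof.
move=> sf It; have := derivableP (sf n t It).
by rewrite derive1nS derive1E.
Qed.

End WarpingFunction.

Theorem proposition3p1 (R : realType) (c : R)
    (M : oriented_surface R) (g : riemannian_metric M)
    (nabla : (M -> plane R) -> (M -> plane R) -> (M -> plane R))
    (nabla_lc : levi_civita g nabla)
    (K : M -> R) (K_gauss : gaussian_curvature g nabla K)
    (grad_neq0 : forall p : M, grad g K p != 0)
    (K_lt_c : forall p : M, 0 < c - K p)
    (X1 : M -> plane R)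
    (X1_def : forall p : M,
       X1 p = (metric_norm g p (grad g K p))^-1 *: grad g K p)
    (X2 : M -> plane R) (X2_smooth : smooth_field X2)
    (frame : forall p : M, oriented_orthonormal g p (X1 p) (X2 p)) :
  ((forall p : M, act X2 (act X1 K) p = 0) /\
   (forall p : M, nabla X2 X2 p
      = - (3 * act X1 K p / (8 * (c - K p))) *: X1 p))
  <->
  (forall p : M, exists (x : chart R M) (I : set R) (phi k : R -> R),
     let u := fst \o chart_map x in
     let v := snd \o chart_map x in
     [/\ local_coordinates x /\ chart_dom x p,
         [/\ open I, is_interval I, u @` chart_dom x = I & smooth1 I phi],
         forall q, chart_dom x q -> forall a b : plane R,
           g q a b = expR (2 * phi (u q)) *
             (differential u q a * differential u q b
              + differential v q a * differential v q b),
         forall q, chart_dom x q -> K q = k (u q)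
       & forall t, I t ->
         [/\ 8 * c * expR (2 * phi t) * phi^`()%classic t
               + 2 * phi^`()%classic t * phi^`(2)%classic t
               + 3 * phi^`(3)%classic t = 0,
             is_derive t 1 k
               (expR (- 2 * phi t) *
                (2 * phi^`()%classic t * phi^`(2)%classic t
                 - phi^`(3)%classic t)),
             expR (- 2 * phi t) *
               (2 * phi^`()%classic t * phi^`(2)%classic t
                - phi^`(3)%classic t) != 0,
             c - k t = c + expR (- 2 * phi t) * phi^`(2)%classic t
           & 0 < c - k t]]).
Proof.
have sX1 : smooth_field X1 := smooth_rotation X2_smooth frame.
have X1K_gt0 p : 0 < act X1 K p := act1_K_gt0 frame grad_neq0 X1_def p.
have X2K p : act X2 K p = 0 := act2_K frame grad_neq0 X1_def p.
have X2X1K p : act X2 (act X1 K) p = geod1 g nabla X1 X2 p * act X1 K p.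
  exact: (act21_K nabla_lc sX1 X2_smooth frame K_gauss grad_neq0 X1_def).
have sK : smooth_fun K :=
  smooth_gaussian_curvature nabla_lc sX1 X2_smooth frame K_gauss.
have X22 p : nabla X2 X2 p = geod2 g nabla X1 X2 p *: X1 p.
  exact: (nabla22 nabla_lc X2_smooth frame).
have dK p : diff_at K p := smooth_on_diff_at openT sK I.
split; last first.
  move=> iso; suff main p : geod1 g nabla X1 X2 p = 0 /\
      geod2 g nabla X1 X2 p = - (3 * act X1 K p / (8 * (c - K p))).
    split=> p; first by rewrite X2X1K (main p).1 mul0r.
    by rewrite X22 (main p).2.
  have [x [J [phi [k [[lx xp] [oJ _ uJ sphi] gE KE ode]]]]] := iso p.
  set u := fst \o chart_map x in uJ gE KE.
  have Ju q : chart_dom x q -> J (u q) by move=> xq; rewrite -uJ; exists q.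
  have [q xq|a0 X1Kp b] := isothermal_frame nabla_lc sX1 X2_smooth frame X2K
    lx gE KE _ xp (phi' := phi^`()%classic)
    (k' := fun t => expR (- 2 * phi t) *
                (2 * phi^`()%classic t * phi^`(2)%classic t - phi^`(3)%classic t)).
    have [_ dk k0 _ _] := ode _ (Ju q xq).
    split=> //; have := smooth1_is_derive 0 sphi (Ju q xq).
    by rewrite derive1n0 derive1n1.
  split=> //; have [ode_p _ _ cE _] := ode _ (Ju p xp).
  have := (isothermal_ode _ _ cE).1 ode_p; rewrite b X1Kp (KE p xp).
  have cK := K_lt_c p; rewrite KE// in cK.
  set h := expR _ * _; rewrite -/u; move: h (phi^`()%classic (u p)) => h p1 E1.
  have -> : p1 = 3 * h / (8 * (c - k (u p))).
    by rewrite -E1; field; rewrite gt_eqF.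
  by field; rewrite gt_eqF.
move=> [geod X22E] p0.
have a0 p : geod1 g nabla X1 X2 p = 0.
  have := geod p; rewrite X2X1K => /eqP.
  by rewrite mulf_eq0 (gt_eqF (X1K_gt0 p)) orbF => /eqP.
have bE p : geod2 g nabla X1 X2 p = - (3 * act X1 K p / (8 * (c - K p))).
  have := X22E p; rewrite X22 => E.
  have [xx _ _ _] := frame p.
  by have := congr1 (fun w => g p w (X1 p)) E; rewrite /= !innerZl xx !mulr1.
have cK0 p : c - K p != 0 by rewrite gt_eqF.
(* The condition [X1 rho = geod2 * rho] holds because [geod2] is [3/8] times the
   logarithmic derivative of [c - K] along [X1]. *)
pose rho p := expR (3 / 8 * ln (c - K p)).
have srho : smooth_fun rho.
  apply: (smooth_on_expR openT); apply: (smooth_on_mul openT (smooth_on_cst _ openT)).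
  apply: (smooth_on_ln openT) => [|p _]; last exact: K_lt_c.
  exact: smooth_on_sub_fun openT (smooth_on_cst _ openT) sK.
have rho0 p : 0 < rho p by exact: expR_gt0.
have dlnK p : is_derive (K p) 1 (fun s =>
  3 / 8 * ln (c - s)) (3 / 8 * (- (c - K p)^-1)).
  exact/is_derive_scale/is_derive_ln_sub.
have actrho Z p : act Z rho p = rho p * (3 / 8 * (- (c - K p)^-1)) * act Z K p.
  exact: (act_comp (t := fun s => expR (3 / 8 * ln (c - s))) Z (dK p)
    (is_derive_expR_comp (dlnK p))).
have X2rho p : act X2 rho p = 0 by rewrite actrho X2K mulr0.
have X1rho p : act X1 rho p = geod2 g nabla X1 X2 p * rho p.
  by rewrite actrho bE; field.
have [x [z [s [lx xp s0 imx xE]]]] :=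
  isothermal_chart nabla_lc sX1 X2_smooth frame srho rho0 a0 X1rho X2rho p0.
set u := fst \o chart_map x in xE; set v := snd \o chart_map x in xE.
have ox : open (chart_dom x) by exact: chart_dom_open.
have [su sv] : smooth_on (chart_dom x) u /\ smooth_on (chart_dom x) v.
  exact: smooth_on_coord.
have oB : open (ball z s) by exact: open_square.
pose Kx := K \o chart_inv x.
have sKx : smooth (ball z s) Kx.
  rewrite -imx -[chart_dom x]setIT; exact: smooth_on_chart lx openT sK.
pose k t := Kx (t, z.2); pose phi t := - (3 / 8) * ln (c - k t).
pose J : set R := [set t | `|z.1 - t| < s].
have BJ t : J t -> ball z s (t, z.2).
  by move=> Jt; apply/ball_planeE; rewrite /= subrr normr0.
have xB q : chart_dom x q -> ball z s (chart_map x q) by move=> xq; rewrite -imx;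
  exists q.
have Jx q : chart_dom x q -> J (u q) by move=> /xB/ball_planeE[].
have uJ : u @` chart_dom x = J.
  apply/seteqP; split=> [_ [q xq <-]|t Jt]; first exact: Jx.
  by have := BJ t Jt; rewrite -imx => -[q xq E]; exists q => //; rewrite /u /= E.
have oJ : open J.
  have -> : J = ball z.1 s by [].
  exact: ball_open.
have iJ : is_interval J.
  move=> a b; rewrite /J /= !ltr_norml => /andP[? ?] /andP[? ?] t /andP[? ?].
  by rewrite ltr_norml; apply/andP; split; lra.
have Kxq q : chart_dom x q -> Kx (chart_map x q) = K q.
  by move=> xq; rewrite /Kx /= chart_mapK.
(* [K] has no derivative along [X2], hence does not depend on [v]. *)
have Kxdy y : ball z s y -> is_derive y dy Kx 0.
  move=> By; have [_ D] := smooth_derivable sKx By.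
  split=> //; move: By; rewrite -imx => -[q xq <-].
  have dKx := smooth_differentiable oB sKx (xB q xq).
  have := act_chart X2 lx xq dKx; rewrite X2K.
  have [_ -> _ ->] := xE q xq.
  by rewrite mulr0 add0r => /esym/eqP; rewrite mulf_eq0 (gt_eqF (rho0 q)) orbF => /eqP.
have KE q : chart_dom x q -> K q = k (u q).
  move=> xq; have /ball_planeE[b1 b2] := xB q xq; rewrite -Kxq//.
  have [|t _ E] := @MVT_unordered R (fun t => Kx (u q, t)) (fun=> 0) z.2 (v q).
    move=> t tB; apply/(is_derive_line2 Kx (u q, t)); apply: Kxdy.
    apply/ball_planeE; split=> //=; apply: ltr_dist_between tB => //.
    by rewrite subrr normr0.
  move: E; rewrite mul0r => /eqP; rewrite subr_eq0 => /eqP E.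
  by rewrite /k -E /u /v /= -surjective_pairing.
have sphi : smooth1 J phi.
  apply: (smooth1_line oJ BJ (h := fun y => - (3 / 8) * ln (c - Kx y))).
  apply: (smooth_mul oB (smooth_cst _ oB)); apply: (smooth_ln oB) => [|y].
    exact: smooth_sub_fun oB (smooth_cst _ oB) sKx.
  by rewrite -imx => -[q xq <-]; rewrite Kxq.
have rhoE q : chart_dom x q -> rho q = expR (- phi (u q)).
  by move=> xq; rewrite /phi -KE// mulNr opprK.
set p1 := phi^`()%classic; set p2 := phi^`(2)%classic; set p3 := phi^`(3)%classic.
have dphi t : J t -> is_derive t 1 phi (p1 t).
  by move=> Jt; have := smooth1_is_derive 0 sphi Jt; rewrite derive1n0 derive1n1.
have dp1 t : J t -> is_derive t 1 p1 (p2 t).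
  by move=> Jt; have := smooth1_is_derive 1 sphi Jt; rewrite derive1n1.
have dp2 t : J t -> is_derive t 1 p2 (p3 t) by move=> Jt;
  exact: (smooth1_is_derive 2 sphi Jt).
have du q : chart_dom x q -> diff_at u q := smooth_on_diff_at ox su.
have X1u q : chart_dom x q -> act X1 u q = rho q by move=> /xE[].
have bphi q : chart_dom x q -> geod2 g nabla X1 X2 q = - p1 (u q) * expR (- phi (u q)).
  move=> xq; have := act_comp X1 (du q xq) (dphi _ (Jx q xq)).
  have E q' : chart_dom x q' -> phi (u q') = - (3 / 8 * ln (c - K q')).
    by move=> xq'; rewrite /phi -KE// mulNr.
  rewrite (@act_eq _ _ X1 _ _ (fun q => - (3 / 8 * ln (c - K q))) q ox xq E).
  rewrite X1u// rhoE// mulNr => <-.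
  have dln : is_derive (K q) 1 (fun s =>
    - (3 / 8 * ln (c - s))) (- (3 / 8 * (- (c - K q)^-1))).
    by have H := is_deriveN (dlnK q); exact: H.
  by rewrite (act_comp X1 (dK q) dln) bE; field.
have dexp a t : J t -> is_derive t 1 (fun t =>
  expR (a * phi t)) (expR (a * phi t) * (a * p1 t)).
  by move=> Jt; apply: is_derive_expR_comp; apply: is_derive_scale; exact: dphi.
have eX2 t : expR (- phi t) * expR (- phi t) = expR (- 2 * phi t).
  by rewrite -expRD; congr expR; ring.
(* the equation [K = X1 geod2 - geod2 ^ 2] in the coordinate [u] *)
have kE t : J t -> k t = - (expR (- 2 * phi t) * p2 t).
  rewrite -uJ => -[q xq <-];
    rewrite -KE// (curvature_geodesic nabla_lc sX1 X2_smooth frame K_gauss a0).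
  rewrite (@act_eq _ _ X1 _ _ (fun q =>
    - p1 (u q) * expR (- phi (u q))) q ox xq bphi) bphi//.
  have Jq := Jx q xq.
  have dpsi : is_derive (u q) 1 (fun t => - p1 t * expR (- phi t))
     (- p1 (u q) * (expR (- phi (u q)) * - p1 (u q)) + expR (- phi (u q)) * - p2 (u q)).
    have D1 : is_derive (u q) 1 (fun t => - p1 t) (- p2 (u q)).
      by have H := is_deriveN (dp1 _ Jq); exact: H.
    have D2 : is_derive (u q) 1 (fun t => - phi t) (- p1 (u q)).
      by have H := is_deriveN (dphi _ Jq); exact: H.
    exact: (is_derive_mul D1 (is_derive_expR_comp D2)).
  rewrite (act_comp X1 (du q xq) dpsi) X1u// rhoE// -eX2; ring.
pose h t := expR (- 2 * phi t) * (2 * p1 t * p2 t - p3 t).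
have dk t : J t -> is_derive t 1 k (h t).
  move=> Jt; apply: (@near_eq_is_derive _ _ _ (fun t => - (expR (- 2 * phi t) * p2 t))).
    by apply: filterS (open_nbhs_nbhs (conj oJ Jt)) => t' /kE ->.
  have -> : h t = - (expR (- 2 * phi t) * p3 t + p2 t * (expR (- 2 * phi t) * (- 2 *
    p1 t))).
    by rewrite /h; ring.
  by have H := is_deriveN (is_derive_mul (dexp (- 2) t Jt) (dp2 t Jt)); exact: H.
have X1KE q : chart_dom x q -> act X1 K q = h (u q) * rho q.
  move=> xq; rewrite (@act_eq _ _ X1 _ K (k \o u) q ox xq KE).
  by rewrite (act_comp X1 (du q xq) (dk _ (Jx q xq))) X1u.
exists x, J, phi, k; split=> //.
- move=> q xq a b; rewrite -/u -/v.
  have decomp w : differential u q w = g q w (X1 q) * rho q /\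
                  differential v q w = g q w (X2 q) * rho q.
    have [e1 e2 e3 e4] := xE q xq.
    have dv := smooth_on_diff_at ox sv xq.
    rewrite {1 3}(frame_decomp frame q w) !differential_linear//; last exact: du.
    by rewrite -!/(act X1 _ q) -!/(act X2 _ q) e1 e2 e3 e4 !mulr0 addr0 add0r.
  have [-> ->] := decomp a; have [-> ->] := decomp b.
  have -> : expR (2 * phi (u q)) = (rho q)^-2.
    rewrite rhoE// -expRM_natl -expRN; congr expR; ring.
  have -> : g q a b = g q a (X1 q) * g q b (X1 q) + g q a (X2 q) * g q b (X2 q).
    by rewrite [in LHS](frame_decomp frame q b) innerDZr; ring.
  by field; rewrite gt_eqF.
- move=> t Jt; rewrite -/p1 -/p2 -/p3 -/(h t).
  have : J t := Jt; rewrite -uJ => -[q xq uq].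
  have ckt : c - k t = c + expR (- 2 * phi t) * p2 t by rewrite kE// opprK.
  have ht : h t = 8 * (c - k t) * p1 t / 3.
    have := bphi q xq; rewrite bE X1KE// KE// uq rhoE// uq.
    have ck0 := cK0 q; rewrite KE// uq in ck0.
    have e0 : expR (- phi t) != 0 by rewrite gt_eqF ?expR_gt0.
    move: (expR (- phi t)) e0 ck0 => e e0 ck0 E.
    have -> : p1 t = - (- p1 t * e) / e by field.
    by rewrite -E; field; rewrite e0 ck0.
  split.
  + by apply/(isothermal_ode _ _ ckt); rewrite -/(h t) ht; field.
  + exact: dk.
  + have := X1K_gt0 q; rewrite X1KE// uq => H.
    by apply: contraTneq H => ->; rewrite mul0r ltxx.
  + exact: ckt.
  + by rewrite -uq -KE.
Qed.
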